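(* Let $\mathfrak{g}$ be a complex Kac--Moody algebra, $\lambda\in\mathfrak{h}^*$, let $V$ be a nonzero quotient of the Verma module $M(\lambda)$, and set $S:=\mathrm{wt}\,V$. There exist unique maximum and minimum modules $V^{\max}(S)$, $V^{\min}(S)$ of highest weight $\lambda$ (i.e. quotients of $M(\lambda)$) with the property: a module $V'$ with $M(\lambda)\twoheadrightarrow V'$ has $\mathrm{wt}\,V'=S$ if and only if $$V^{\max}(S)\twoheadrightarrow V'\twoheadrightarrow V^{\min}(S).$$ In particular, $\mathrm{wt}\,V^{\max}(S)=\mathrm{wt}\,V^{\min}(S)=S$.
   Context: Work over $\mathbb{C}$. Fix a generalized Cartan matrix indexed by a finite set $I$, with a realization with Cartan subalgebra $\mathfrak{h}$. ''Kac--Moody algebra'' means any Lie algebra $\mathfrak{g}$ with $\widetilde{\mathfrak{g}} \twoheadrightarrow \mathfrak{g} \twoheadrightarrow \overline{\mathfrak{g}}$, where $\widetilde{\mathfrak{g}}$ is generated by $\mathfrak{h}$ and Chevalley generators $e_i, f_i$ ($i\in I$) subject to the Chevalley--Serre relations, and $\overline{\mathfrak{g}}$ is the quotient of $\widetilde{\mathfrak{g}}$ by its maximal ideal meeting $\mathfrak{h}$ trivially. $M(\lambda)$ is the Verma module, and $\mathrm{wt}\,V=\{\mu\in\mathfrak{h}^*:V_\mu\neq0\}$ where $V_\mu$ is the $\mu$-weight space. The symbol $\twoheadrightarrow$ denotes a surjective $\mathfrak{g}$-module map; modules are considered up to isomorphism. *)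

(* Defs.v *)
From HB Require Import structures.
From mathcomp Require Import all_boot all_order all_algebra.
From mathcomp Require Import boolp classical_sets reals complex.

Set Implicit Arguments.
Unset Strict Implicit.
Unset Printing Implicit Defensive.

Import GRing.Theory.
Local Open Scope ring_scope.
Local Open Scope quotient_scope.

HB.mixin Record Lmodule_isLieAlgebra (K : fieldType) L of GRing.Lmodule K L := {
  lie : L -> L -> L;
  lie_linearl : forall a x y z, lie (a *: x + y) z = a *: lie x z + lie y z;
  lie_linearr : forall a x y z, lie z (a *: x + y) = a *: lie z x + lie z y;
  liexx : forall x, lie x x = 0;
  lie_jacobi : forall x y z,
    lie x (lie y z) + lie y (lie z x) + lie z (lie x y) = 0
}.

#[short(type="lieAlgType")]
HB.structure Definition LieAlgebra (K : fieldType) :=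
  { L of Lmodule_isLieAlgebra K L & GRing.Lmodule K L }.

Notation "[ 'lie' x , y ]" := (lie x y) (format "[ 'lie'  x ,  y ]").

HB.mixin Record Lmodule_isLieModule (K : fieldType) (g : lieAlgType K) V
    of GRing.Lmodule K V := {
  lact : g -> V -> V;
  lact_linearl : forall a x y v, lact (a *: x + y) v = a *: lact x v + lact y v;
  lact_linearr : forall a x u v, lact x (a *: u + v) = a *: lact x u + lact x v;
  lact_lie : forall x y v,
    lact [lie x, y] v = lact x (lact y v) - lact y (lact x v)
}.

#[short(type="lieModType")]
HB.structure Definition LieModule (K : fieldType) (g : lieAlgType K) :=
  { V of Lmodule_isLieModule K g V & GRing.Lmodule K V }.

Section Morphisms.
Context (K : fieldType).

Definition lie_morphism (g g' : lieAlgType K) (p : {linear g -> g'}) : Prop :=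
  forall x y, p [lie x, y] = [lie p x, p y].

Definition lie_ideal (g : lieAlgType K) (J : set g) : Prop :=
  [/\ J 0, forall a x y, J x -> J y -> J (a *: x + y)
    & forall x y, J y -> J [lie x, y]].

Definition lmod_morphism (g : lieAlgType K) (V W : lieModType g)
    (f : {linear V -> W}) : Prop :=
  forall x v, f (lact x v) = lact x (f v).

Definition surjects (g : lieAlgType K) (V W : lieModType g) : Prop :=
  exists f : {linear V -> W},
    lmod_morphism f /\ forall w, exists v, f v = w.

Definition lmod_iso (g : lieAlgType K) (V W : lieModType g) : Prop :=
  exists f : {linear V -> W}, lmod_morphism f /\ bijective f.

End Morphisms.

(* Vector spaces presented by generators and relations.  A [linsig] consists  *)
(* of formal expressions (with formal zero, sum, opposite and scaling), a     *)
(* family of further unary operations that must pass to the quotient, and the *)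
(* defining relations; [linquot S] is the quotient by the least congruence    *)
(* that contains the relations and the vector space axioms.                   *)
Record linsig (K : fieldType) := LinSig {
  ls_term : Type;
  ls_zero : ls_term;
  ls_add : ls_term -> ls_term -> ls_term;
  ls_opp : ls_term -> ls_term;
  ls_scale : K -> ls_term -> ls_term;
  ls_idx : Type;
  ls_op : ls_idx -> ls_term -> ls_term;
  ls_rel : ls_term -> ls_term -> Prop
}.

Section LinQuot.
Context (K : fieldType) (S : linsig K).
Local Notation T := (ls_term S).
Local Notation "x +' y" := (ls_add x y) (at level 50, left associativity).
Local Notation "a *' x" := (ls_scale a x) (at level 40).

Inductive lincong : T -> T -> Prop :=
| lc_rel x y : ls_rel x y -> lincong x y
| lc_refl x : lincong x x
| lc_sym x y : lincong x y -> lincong y x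
| lc_trans x y z : lincong x y -> lincong y z -> lincong x z
| lc_add x x' y y' : lincong x x' -> lincong y y' ->
    lincong (x +' y) (x' +' y')
| lc_opp x x' : lincong x x' -> lincong (ls_opp x) (ls_opp x')
| lc_scale a x x' : lincong x x' -> lincong (a *' x) (a *' x')
| lc_op i x x' : lincong x x' -> lincong (ls_op i x) (ls_op i x')
| lc_addA x y z : lincong (x +' (y +' z)) ((x +' y) +' z)
| lc_addC x y : lincong (x +' y) (y +' x)
| lc_add0 x : lincong (ls_zero S +' x) x
| lc_addN x : lincong (ls_opp x +' x) (ls_zero S)
| lc_scaleA a b x : lincong (a *' (b *' x)) ((a * b) *' x)
| lc_scale1 x : lincong (1 *' x) x
| lc_scaleDr a x y : lincong (a *' (x +' y)) ((a *' x) +' (a *' y))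
| lc_scaleDl x a b : lincong ((a + b) *' x) ((a *' x) +' (b *' x)).

Definition lincong_term : Type := T.
HB.instance Definition _ := gen_eqMixin lincong_term.
HB.instance Definition _ := gen_choiceMixin lincong_term.

Definition lincongb (x y : lincong_term) : bool := `[< lincong x y >].

Lemma lincongb_equiv : equiv_class_of lincongb.
Proof.
split=> [x|x y|y x z].
- by apply/asboolP; exact: lc_refl.
- by apply/asboolP/asboolP; exact: lc_sym.
- move=> /asboolP xy /asboolP yz; apply/asboolP; exact: lc_trans yz.
Qed.

Canonical lincong_equiv_rel := EquivRelPack lincongb_equiv.

Definition linquot : Type := {eq_quot lincong_equiv_rel}.
HB.instance Definition _ := Choice.on linquot.

Definition lincls (x : T) : linquot := \pi_{eq_quot lincong_equiv_rel} x.
Definition linrep (q : linquot) : T := repr (q : {eq_quot lincong_equiv_rel}).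

Lemma linclsP x y : lincls x = lincls y <-> lincong x y.
Proof.
rewrite /lincls; split=> [/eqmodP/asboolP //|xy].
by apply/eqmodP/asboolP.
Qed.

Lemma linrepK : cancel linrep lincls.
Proof. by move=> q; rewrite /lincls /linrep reprK. Qed.

Lemma lincls_surj q : exists x, q = lincls x.
Proof. by exists (linrep q); rewrite linrepK. Qed.

Lemma linrep_cls x : lincong (linrep (lincls x)) x.
Proof. by apply/linclsP; rewrite linrepK. Qed.

Definition linquot0 := lincls (ls_zero S).
Definition linquotD p q := lincls (linrep p +' linrep q).
Definition linquotN p := lincls (ls_opp (linrep p)).
Definition linquotZ a p := lincls (a *' linrep p).

Let addE x y : linquotD (lincls x) (lincls y) = lincls (x +' y).
Proof. by apply/linclsP/lc_add; exact: linrep_cls. Qed.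
Let oppE x : linquotN (lincls x) = lincls (ls_opp x).
Proof. by apply/linclsP/lc_opp; exact: linrep_cls. Qed.
Let scaleE a x : linquotZ a (lincls x) = lincls (a *' x).
Proof. by apply/linclsP/lc_scale; exact: linrep_cls. Qed.

Lemma linquot_addA : associative linquotD.
Proof.
move=> p q r; have [[x ->] [y ->] [z ->]] :=
  And3 (lincls_surj p) (lincls_surj q) (lincls_surj r).
by rewrite !addE; apply/linclsP/lc_addA.
Qed.

Lemma linquot_addC : commutative linquotD.
Proof.
move=> p q; have [[x ->] [y ->]] := conj (lincls_surj p) (lincls_surj q).
by rewrite !addE; apply/linclsP/lc_addC.
Qed.

Lemma linquot_add0 : left_id linquot0 linquotD.
Proof.
by move=> p; have [x ->] := lincls_surj p; rewrite addE; apply/linclsP/lc_add0.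
Qed.

Lemma linquot_addN : left_inverse linquot0 linquotN linquotD.
Proof.
move=> p; have [x ->] := lincls_surj p.
by rewrite oppE addE; apply/linclsP/lc_addN.
Qed.

HB.instance Definition _ := GRing.isZmodule.Build linquot
  linquot_addA linquot_addC linquot_add0 linquot_addN.

Lemma linquot_scaleA a b p : linquotZ a (linquotZ b p) = linquotZ (a * b) p.
Proof.
by have [x ->] := lincls_surj p; rewrite !scaleE; apply/linclsP/lc_scaleA.
Qed.

Lemma linquot_scale1 : left_id 1 linquotZ.
Proof.
by move=> p; have [x ->] := lincls_surj p; rewrite scaleE; apply/linclsP/lc_scale1.
Qed.

Lemma linquot_scaleDr : right_distributive linquotZ +%R.
Proof.
move=> a p q; have [[x ->] [y ->]] := conj (lincls_surj p) (lincls_surj q).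
rewrite /+%R /= !(addE, scaleE); exact/linclsP/lc_scaleDr.
Qed.

Lemma linquot_scaleDl p : {morph linquotZ^~ p : a b / a + b}.
Proof.
move=> a b; have [x ->] := lincls_surj p.
rewrite [RHS]/+%R /= !(addE, scaleE); exact/linclsP/lc_scaleDl.
Qed.

HB.instance Definition _ := GRing.Zmodule_isLmodule.Build K linquot
  linquot_scaleA linquot_scale1 linquot_scaleDr linquot_scaleDl.

Lemma lincls0 : lincls (ls_zero S) = 0. Proof. by []. Qed.
Lemma linclsD x y : lincls (x +' y) = lincls x + lincls y.
Proof. by rewrite -addE. Qed.
Lemma linclsN x : lincls (ls_opp x) = - lincls x.
Proof. by rewrite -oppE. Qed.
Lemma linclsZ a x : lincls (a *' x) = a *: lincls x.
Proof. by rewrite -scaleE. Qed.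

End LinQuot.

Definition generalized_cartan (I : finType) (A : I -> I -> int) : Prop :=
  [/\ forall i, A i i = 2,
      forall i j, i != j -> A i j <= 0
    & forall i j, A i j = 0 -> A j i = 0].

Definition dual (K : fieldType) (h : vectType K) := 'Hom(h, K^o).

Section Cartan.
Context (K : fieldType) (I : finType) (A : I -> I -> int).

Definition cartan_rank : nat :=
  \rank (\matrix_(i < #|I|, j < #|I|) (A (enum_val i) (enum_val j))%:~R : 'M[K]_#|I|).

Record realization := Realization {
  cartan : vectType K;
  root : I -> dual cartan;
  coroot : I -> cartan;
  root_free : free [seq root i | i <- enum I];
  coroot_free : free [seq coroot i | i <- enum I];
  root_coroot : forall i j, root j (coroot i) = (A i j)%:~R;
  dim_cartan : \dim {: cartan} = (#|I| + (#|I| - cartan_rank))%N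
}.

End Cartan.

Section KacMoodyTilde.
Context (K : fieldType) (I : finType) (A : I -> I -> int) (rz : realization K A).
Local Notation h := (cartan rz).

Inductive km_term :=
| KmH of h
| KmE of I
| KmF of I
| KmZero
| KmAdd of km_term & km_term
| KmOpp of km_term
| KmScale of K & km_term
| KmLie of km_term & km_term.

Local Notation lin a x y := (KmAdd (KmScale a x) y).

Inductive km_rel : km_term -> km_term -> Prop :=
| kr_linearl a x y z :
    km_rel (KmLie (lin a x y) z) (lin a (KmLie x z) (KmLie y z))
| kr_linearr a x y z :
    km_rel (KmLie z (lin a x y)) (lin a (KmLie z x) (KmLie z y))
| kr_xx x : km_rel (KmLie x x) KmZero
| kr_jacobi x y z :
    km_rel (KmAdd (KmAdd (KmLie x (KmLie y z)) (KmLie y (KmLie z x)))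
              (KmLie z (KmLie x y))) KmZero
| kr_H_linear a x y : km_rel (KmH (a *: x + y)) (lin a (KmH x) (KmH y))
| kr_HH x y : km_rel (KmLie (KmH x) (KmH y)) KmZero
| kr_HE x i : km_rel (KmLie (KmH x) (KmE i)) (KmScale (root rz i x) (KmE i))
| kr_HF x i : km_rel (KmLie (KmH x) (KmF i)) (KmScale (- root rz i x) (KmF i))
| kr_EF i j :
    km_rel (KmLie (KmE i) (KmF j)) (if i == j then KmH (coroot rz i) else KmZero)
| kr_serreE i j : i != j ->
    km_rel (iter `|1 - A i j|%N (KmLie (KmE i)) (KmE j)) KmZero
| kr_serreF i j : i != j ->
    km_rel (iter `|1 - A i j|%N (KmLie (KmF i)) (KmF j)) KmZero.

Definition km_op (s : km_term + km_term) (x : km_term) : km_term :=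
  match s with inl y => KmLie y x | inr y => KmLie x y end.

Definition km_sig : linsig K :=
  LinSig KmZero KmAdd KmOpp KmScale km_op km_rel.

Definition km_tilde : Type := linquot km_sig.
HB.instance Definition _ := GRing.Lmodule.on km_tilde.

Definition km_cls (x : km_term) : km_tilde := @lincls K km_sig x.

Definition km_lie (p q : km_tilde) : km_tilde :=
  km_cls (KmLie (@linrep K km_sig p) (@linrep K km_sig q)).

Lemma km_clsP (x y : km_term) :
  km_cls x = km_cls y <-> @lincong K km_sig x y.
Proof. exact: linclsP. Qed.

Lemma km_cls_surj (p : km_tilde) : exists x, p = km_cls x.
Proof. exact: (@lincls_surj K km_sig). Qed.

Lemma km_cls0 : km_cls KmZero = 0. Proof. by []. Qed.
Lemma km_clsD x y : km_cls (KmAdd x y) = km_cls x + km_cls y.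
Proof. exact: (@linclsD K km_sig). Qed.
Lemma km_clsN x : km_cls (KmOpp x) = - km_cls x.
Proof. exact: (@linclsN K km_sig). Qed.
Lemma km_clsZ a x : km_cls (KmScale a x) = a *: km_cls x.
Proof. exact: (@linclsZ K km_sig). Qed.

Lemma km_lieE x y : km_lie (km_cls x) (km_cls y) = km_cls (KmLie x y).
Proof.
apply/km_clsP; apply: (@lc_trans K km_sig _ (KmLie x (@linrep K km_sig (km_cls y)))).
  by apply: (@lc_op K km_sig (inr _)); exact: (@linrep_cls K km_sig).
by apply: (@lc_op K km_sig (inl _)); exact: (@linrep_cls K km_sig).
Qed.

Lemma km_cls_rel x y : km_rel x y -> km_cls x = km_cls y.
Proof. by move=> xy; apply/km_clsP; exact: (@lc_rel K km_sig). Qed.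

Lemma km_lie_linearl a x y z :
  km_lie (a *: x + y) z = a *: km_lie x z + km_lie y z.
Proof.
have [[x' ->] [y' ->] [z' ->]] :=
  And3 (km_cls_surj x) (km_cls_surj y) (km_cls_surj z).
rewrite -km_clsZ -km_clsD !km_lieE -km_clsZ -km_clsD.
exact/km_cls_rel/kr_linearl.
Qed.

Lemma km_lie_linearr a x y z :
  km_lie z (a *: x + y) = a *: km_lie z x + km_lie z y.
Proof.
have [[x' ->] [y' ->] [z' ->]] :=
  And3 (km_cls_surj x) (km_cls_surj y) (km_cls_surj z).
rewrite -km_clsZ -km_clsD !km_lieE -km_clsZ -km_clsD.
exact/km_cls_rel/kr_linearr.
Qed.

Lemma km_liexx x : km_lie x x = 0.
Proof.
by have [x' ->] := km_cls_surj x; rewrite km_lieE; exact/km_cls_rel/kr_xx.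
Qed.

Lemma km_lie_jacobi x y z :
  km_lie x (km_lie y z) + km_lie y (km_lie z x) + km_lie z (km_lie x y) = 0.
Proof.
have [[x' ->] [y' ->] [z' ->]] :=
  And3 (km_cls_surj x) (km_cls_surj y) (km_cls_surj z).
rewrite !km_lieE -!km_clsD; exact/km_cls_rel/kr_jacobi.
Qed.

HB.instance Definition _ := Lmodule_isLieAlgebra.Build K km_tilde
  km_lie_linearl km_lie_linearr km_liexx km_lie_jacobi.

Definition meets_cartan_trivially (J : set km_tilde) : Prop :=
  forall x : h, J (km_cls (KmH x)) -> km_cls (KmH x) = 0.

Definition max_ideal_off_cartan (J : set km_tilde) : Prop :=
  [/\ lie_ideal J, meets_cartan_trivially J
    & forall J', lie_ideal J' -> meets_cartan_trivially J' -> (J' `<=` J)%classic].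

(* A Lie algebra g with surjections km_tilde ->> g ->> gbar whose composite   *)
(* is the quotient of km_tilde by the largest ideal meeting h trivially.      *)
Record kac_moody := KacMoody {
  km_alg :> lieAlgType K;
  km_proj : {linear km_tilde -> km_alg};
  km_proj_lie : lie_morphism km_proj;
  km_proj_surj : forall y, exists x, km_proj x = y;
  km_to_bar : exists (gbar : lieAlgType K) (q : {linear km_alg -> gbar}),
    [/\ lie_morphism q, forall z, exists y, q y = z
      & max_ideal_off_cartan [set x | q (km_proj x) = 0]%classic]
}.

End KacMoodyTilde.

Section WeightsVerma.
Context (K : fieldType) (I : finType) (A : I -> I -> int) (rz : realization K A).
Context (g : kac_moody rz).
Local Notation h := (cartan rz).

Definition km_h (x : h) : g := km_proj g (km_cls (KmH x)).
Definition km_e (i : I) : g := km_proj g (km_cls (KmE rz i)).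
Definition km_f (i : I) : g := km_proj g (km_cls (KmF rz i)).

Definition weight_space (V : lieModType g) (mu : dual h) : set V :=
  [set v : V | forall x : h, lact (km_h x) v = (mu x : K) *: v]%classic.

Definition wt (V : lieModType g) : set (dual h) :=
  [set mu | exists2 v : V, weight_space mu v & v != 0]%classic.

Inductive verma_term :=
| VmHw
| VmZero
| VmAdd of verma_term & verma_term
| VmOpp of verma_term
| VmScale of K & verma_term
| VmAct of g & verma_term.

Local Notation vlin a u v := (VmAdd (VmScale a u) v).

(* The g-module on one generator v subject to e_i v = 0 and h v = lam(h) v,   *)
(* that is U(g) modulo the left ideal generated by n^+ (itself generated by   *)
(* the e_i) and the h - lam(h).                                               *)
Inductive verma_rel (lam : dual h) : verma_term -> verma_term -> Prop :=
| vr_linearl a x y v :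
    verma_rel lam (VmAct (a *: x + y) v) (vlin a (VmAct x v) (VmAct y v))
| vr_linearr a x u v :
    verma_rel lam (VmAct x (vlin a u v)) (vlin a (VmAct x u) (VmAct x v))
| vr_lie x y v :
    verma_rel lam (VmAct [lie x, y] v)
      (VmAdd (VmAct x (VmAct y v)) (VmOpp (VmAct y (VmAct x v))))
| vr_e i : verma_rel lam (VmAct (km_e i) VmHw) VmZero
| vr_h x : verma_rel lam (VmAct (km_h x) VmHw) (VmScale (lam x) VmHw).

Definition verma_sig (lam : dual h) : linsig K :=
  LinSig VmZero VmAdd VmOpp VmScale VmAct (verma_rel lam).

Definition verma (lam : dual h) : Type := linquot (verma_sig lam).

Section Verma.
Context (lam : dual h).
Local Notation M := (verma lam).
Local Notation S := (verma_sig lam).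

HB.instance Definition _ := GRing.Lmodule.on M.

Definition verma_cls (v : verma_term) : M := @lincls K S v.

Definition verma_act (x : g) (v : M) : M := verma_cls (VmAct x (@linrep K S v)).

Lemma verma_cls_surj (u : M) : exists v, u = verma_cls v.
Proof. exact: (@lincls_surj K S). Qed.

Lemma verma_clsP u v : verma_cls u = verma_cls v <-> @lincong K S u v.
Proof. exact: linclsP. Qed.

Lemma verma_cls0 : verma_cls VmZero = 0. Proof. by []. Qed.
Lemma verma_clsD u v : verma_cls (VmAdd u v) = verma_cls u + verma_cls v.
Proof. exact: (@linclsD K S). Qed.
Lemma verma_clsN v : verma_cls (VmOpp v) = - verma_cls v.
Proof. exact: (@linclsN K S). Qed.
Lemma verma_clsZ a v : verma_cls (VmScale a v) = a *: verma_cls v.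
Proof. exact: (@linclsZ K S). Qed.

Lemma verma_actE x v : verma_act x (verma_cls v) = verma_cls (VmAct x v).
Proof. by apply/verma_clsP/(@lc_op K S); exact: (@linrep_cls K S). Qed.

Lemma verma_cls_rel u v : verma_rel lam u v -> verma_cls u = verma_cls v.
Proof. by move=> uv; apply/verma_clsP; exact: (@lc_rel K S). Qed.

Lemma verma_act_linearl a x y v :
  verma_act (a *: x + y) v = a *: verma_act x v + verma_act y v.
Proof.
have [v' ->] := verma_cls_surj v.
rewrite !verma_actE -verma_clsZ -verma_clsD; exact/verma_cls_rel/vr_linearl.
Qed.

Lemma verma_act_linearr a x u v :
  verma_act x (a *: u + v) = a *: verma_act x u + verma_act x v.
Proof.
have [[u' ->] [v' ->]] := conj (verma_cls_surj u) (verma_cls_surj v).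
rewrite -verma_clsZ -verma_clsD !verma_actE -verma_clsZ -verma_clsD.
exact/verma_cls_rel/vr_linearr.
Qed.

Lemma verma_act_lie x y v :
  verma_act [lie x, y] v =
  verma_act x (verma_act y v) - verma_act y (verma_act x v).
Proof.
have [v' ->] := verma_cls_surj v.
rewrite !verma_actE -verma_clsN -verma_clsD; exact/verma_cls_rel/vr_lie.
Qed.

HB.instance Definition _ := Lmodule_isLieModule.Build K g M
  verma_act_linearl verma_act_linearr verma_act_lie.

End Verma.

(* For Vmax and Vmin of highest weight lam: the quotients of M(lam) with      *)
(* weight set S are exactly the modules lying between Vmax and Vmin.          *)
Definition weight_set_bounds (lam : dual h) (S : set (dual h))
    (Vmax Vmin : lieModType g) : Prop :=
  forall V' : lieModType g, surjects (verma lam) V' ->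
    (wt V' = S <-> surjects Vmax V' /\ surjects V' Vmin).

End WeightsVerma.

(* Main.v *)
Require Import Defs.
From HB Require Import structures.
From mathcomp Require Import all_boot all_order all_algebra.
From mathcomp Require Import boolp classical_sets reals complex.
From mathcomp Require Import ring zify.
Import Order.TTheory GRing.Theory Num.Theory.
Set Implicit Arguments.
Unset Strict Implicit.
Unset Printing Implicit Defensive.
Local Open Scope ring_scope.

(** Quotients of M(lam) correspond to submodules of M(lam), and larger
    submodules leave fewer weights.  The largest module with weight set S is
    the quotient by the submodule generated by the weight spaces outside S.
    The difficulty is the smallest one: two submodules, each leaving part of
    the weight space M(lam)_mu, might together exhaust it, so that the sum of
    all submodules whose quotient has weight set S could lose a weight of S.

    This does not happen, because the weights of a highest weight module are
    determined by weight spaces of dimension at most one.  Let T be a set of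
    pairwise non-adjacent vertices i at which the label l_i of lam is a natural
    number.  The product of the f_i ^ (l_i + 1), i in T, applied to the highest
    weight vector v is a singular vector [hole_vector T v], and since these f_i
    commute it spans its weight space.  By [wt_determined], if
    [hole_vector T v != 0] implies [hole_vector T v' != 0] for all T, then
    every weight of the module of v is a weight of the module of v'.  A sum of
    submodules avoiding a one-dimensional weight space still avoids it, so the
    largest submodule of M(lam) avoiding the nonzero hole vectors of V is the
    one that defines the smallest module.

    To prove [wt_determined], take a word w in the f_i with f_w v <> 0, of
    weight mu, and argue by induction on its length.  If mu is negative at some
    vertex and f_w v can be raised by e_i to the reflected weight, induction
    gives the reflected weight, and a string of sl(2) comes back down to mu.
    Otherwise, let S consist of the vertices where mu is not dominant integral,
    together with those letters of w of label 0 that can be moved to its right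
    end.  Nilpotency of the f_i modulo submodules shows that hole_vector T v
    is nonzero for all T inside S.  Then [subset_weight] produces mu: for
    a suitable T, pass to a quotient of the module of v' in which every nonzero
    submodule contains hole_vector T v', so that f_i is injective whenever the
    weight of the hole vector at i is not a natural number.  From the
    weight of the hole vector one can descend to mu by sl(2)-strings
    ([descent_reaches]), treating first the vertices of S, in decreasing order
    of multiplicity, and then the other ones, where an inequality for Cartan
    matrices ([min_ratio]) shows that the descent can only stop at mu. *)

(** * Lie modules: submodules, quotients, factorisation *)

Section LieModules.
Context (K : fieldType) (g : lieAlgType K).

HB.instance Definition _ (V : lieModType g) (x : g) :=
  @GRing.isLinear.Build K V V *:%R (lact x) (fun a => @lact_linearr K g V a x).

HB.instance Definition _ (x : g) :=
  @GRing.isLinear.Build K g g *:%R (lie x) (fun a u v => @lie_linearr K g a u v x).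

Section OneModule.
Context (V : lieModType g).
Implicit Types (N B C : set V) (u v : V) (x y : g).

Lemma lactDl x y v : lact (x + y) v = lact x v + lact y v.
Proof. by rewrite -[x]scale1r lact_linearl !scale1r. Qed.

Lemma lact0l v : lact (0 : g) v = 0.
Proof. by apply/(addrI (lact (0 : g) v)); rewrite -lactDl !addr0. Qed.

Lemma lactZl a x v : lact (a *: x) v = a *: lact x v.
Proof. by rewrite -[a *: x]addr0 lact_linearl lact0l addr0. Qed.

Lemma lactNl x v : lact (- x) v = - lact x v.
Proof. by rewrite -scaleN1r lactZl scaleN1r. Qed.

Lemma lactZr a x v : lact x (a *: v) = a *: lact x v.
Proof. exact: linearZ. Qed.

Definition subspace N :=
  N 0 /\ forall a u v, N u -> N v -> N (a *: u + v).

Definition submod N := subspace N /\ forall x u, N u -> N (lact x u).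

(** The largest submodule inside [C], as soon as [C] is a subspace. *)
Definition core C : set V := [set u | exists N, [/\ submod N, (N `<=` C)%classic & N u]]%classic.

Definition gen (X : set V) : set V :=
  [set u | forall N, submod N -> (X `<=` N)%classic -> N u]%classic.

Lemma subspace_add N u v : subspace N -> N u -> N v -> N (u + v).
Proof. by move=> [_ H] Nu Nv; rewrite -[u]scale1r; apply: H. Qed.

Lemma subspace_scale N a u : subspace N -> N u -> N (a *: u).
Proof. by move=> [H0 H] Nu; rewrite -[_ *: _]addr0; apply: H. Qed.

Lemma subspace_opp N u : subspace N -> N u -> N (- u).
Proof. by move=> sN Nu; rewrite -scaleN1r; apply: subspace_scale. Qed.

Lemma submod0 : submod [set 0]%classic.
Proof.
split; first by split=> // a u v -> ->; rewrite scaler0 addr0.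
by move=> x u ->; rewrite linear0.
Qed.

Lemma gen_submod X : submod (gen X).
Proof.
split; first split.
- by move=> N [[]].
- by move=> a u v Gu Gv N sN XN; apply: sN.1.2; [exact: Gu | exact: Gv].
- by move=> x u Gu N sN XN; apply: sN.2; exact: Gu.
Qed.

Lemma sub_gen X : (X `<=` gen X)%classic.
Proof. by move=> u Xu N _; exact. Qed.

Lemma core_sub C : (core C `<=` C)%classic.
Proof. by move=> u [N [_ NC Nu]]; exact: NC. Qed.

Lemma core_max C N : submod N -> (N `<=` C)%classic -> (N `<=` core C)%classic.
Proof. by move=> sN NC u Nu; exists N. Qed.

Lemma core_submod C : subspace C -> submod (core C).
Proof.
move=> sC; split; first split.
- exists [set 0]%classic; split=> //; [exact: submod0 | by move=> _ ->; case: sC].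
- move=> a u v [N [sN NC Nu]] [N' [sN' NC' Nv]].
  exists [set w | exists p q, [/\ N p, N' q & w = p + q]]%classic; split.
  + split; first split.
    * by exists 0, 0; split; [case: sN.1 | case: sN'.1 | rewrite addr0].
    * move=> b _ _ [p [q [Np Nq ->]]] [p' [q' [Np' Nq' ->]]].
      exists (b *: p + p'), (b *: q + q'); split; [exact: sN.1.2 | exact: sN'.1.2 |].
      by rewrite scalerDr addrACA.
    * move=> x _ [p [q [Np Nq ->]]]; exists (lact x p), (lact x q).
      by split; [exact: sN.2 | exact: sN'.2 | rewrite linearD].
  + by move=> _ [p [q [Np Nq ->]]]; apply: subspace_add => //; [exact: NC | exact: NC'].
  + by exists (a *: u), v; split=> //; apply: subspace_scale => //; case: sN.
- by move=> x u [N [sN NC Nu]]; exists N; split=> //; exact: sN.2.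
Qed.

End OneModule.

Section Quotient.
Context (V : lieModType g) (N : set V).

(** The congruence presented by these data is already generated by the
    differences in [N]; since the action is among the operations that pass to
    the quotient, the module structure exists for every [N], which has to be a
    submodule only for [N] to be the kernel. *)
Definition quot_sig : linsig K :=
  @LinSig K V 0 +%R -%R *:%R g lact (fun u v => N (u - v)).

Definition quot : Type := linquot quot_sig.
HB.instance Definition _ := GRing.Lmodule.on quot.

Definition qproj (u : V) : quot := @lincls K quot_sig u.

Lemma qproj_is_linear : linear qproj.
Proof.
move=> a u v; apply: etrans (@linclsD K quot_sig (a *: u) v) _.
by congr (_ + _); exact: (@linclsZ K quot_sig).
Qed.
HB.instance Definition _ := @GRing.isLinear.Build K V quot *:%R qproj qproj_is_linear.

Lemma qproj_surj p : exists u, qproj u = p.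
Proof. by have [u ->] := lincls_surj p; exists u. Qed.

Definition qact (x : g) (p : quot) : quot := qproj (lact x (@linrep K quot_sig p)).

Lemma qactE x u : qact x (qproj u) = qproj (lact x u).
Proof. by apply/linclsP/(@lc_op K quot_sig); exact: (@linrep_cls K quot_sig). Qed.

Lemma qact_linearl a x y p : qact (a *: x + y) p = a *: qact x p + qact y p.
Proof. by have [u <-] := qproj_surj p; rewrite !qactE lact_linearl linearP. Qed.

Lemma qact_linearr a x p q : qact x (a *: p + q) = a *: qact x p + qact x q.
Proof.
have [[u <-] [v <-]] := conj (qproj_surj p) (qproj_surj q).
by rewrite -linearP !qactE -linearP lact_linearr.
Qed.

Lemma qact_lie x y p : qact [lie x, y] p = qact x (qact y p) - qact y (qact x p).
Proof. by have [u <-] := qproj_surj p; rewrite !qactE lact_lie linearB. Qed.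

HB.instance Definition _ := Lmodule_isLieModule.Build K g quot
  qact_linearl qact_linearr qact_lie.

Lemma qproj_morph : lmod_morphism qproj.
Proof. by move=> x u; exact: esym (qactE x u). Qed.

Lemma qproj_eq0 u : submod N -> qproj u = 0 <-> N u.
Proof.
move=> sN; have sV := sN.1; rewrite -[u in N u]subr0 -[0]/(qproj 0).
split=> [/linclsP|Nu]; last by apply/linclsP/lc_rel.
elim=> {u} //=.
- by move=> u; rewrite subrr; case: sV.
- by move=> u v _ /(subspace_opp sV); rewrite opprB.
- by move=> u v w _ uv _ vw; rewrite -[u](subrK v) -addrA; exact: subspace_add.
- by move=> u u' v v' _ uu _ vv; rewrite opprD addrACA; exact: subspace_add.
- by move=> u u' _ uu; rewrite -opprD; exact: subspace_opp.
- by move=> a u u' _ uu; rewrite -scalerBr; exact: subspace_scale.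
- by move=> x u u' _ uu; rewrite -linearB; exact: sN.2.
- by move=> u v w; rewrite addrA subrr; case: sV.
- by move=> u v; rewrite [v + u]addrC subrr; case: sV.
- by move=> u; rewrite add0r subrr; case: sV.
- by move=> u; rewrite addNr subrr; case: sV.
- by move=> a b u; rewrite scalerA subrr; case: sV.
- by move=> u; rewrite scale1r subrr; case: sV.
- by move=> a u v; rewrite scalerDr subrr; case: sV.
- by move=> u a b; rewrite scalerDl subrr; case: sV.
Qed.

End Quotient.

Lemma quot_surjects (V : lieModType g) (N : set V) : surjects V (quot N).
Proof. by exists (@qproj V N); split; [exact: qproj_morph | exact: qproj_surj]. Qed.

Lemma surjects_trans (U V W : lieModType g) : surjects U V -> surjects V W -> surjects U W.
Proof.
move=> [f [fm fs]] [h [hm hs]]; exists (h \o f)%FUN; split=> [x u|w] /=.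
  by rewrite fm hm.
by have [v <-] := hs w; have [u <-] := fs v; exists u.
Qed.

Lemma ker_submod (V W : lieModType g) (f : {linear V -> W}) :
  lmod_morphism f -> submod [set u | f u = 0]%classic.
Proof.
move=> fm; split; first split; rewrite /= ?linear0 //.
  by move=> a u v fu fv; rewrite linearP fu fv scaler0 addr0.
by move=> x u fu; rewrite fm fu linear0.
Qed.

Lemma preim_submod (V W : lieModType g) (f : {linear V -> W}) (N : set W) :
  lmod_morphism f -> submod N -> submod [set u | N (f u)]%classic.
Proof.
move=> fm sN; split; first split; rewrite /= ?linear0 //; first by case: sN.1.
  by move=> a u v fu fv; rewrite linearP; apply: sN.1.2.
by move=> x u fu; rewrite fm; exact: sN.2.
Qed.

Lemma surjects_factor (M V W : lieModType g) (p : {linear M -> V}) (q : {linear M -> W}) :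
  lmod_morphism p -> lmod_morphism q ->
  (forall v, exists u, p u = v) -> (forall w, exists u, q u = w) ->
  (forall u, p u = 0 -> q u = 0) -> surjects V W.
Proof.
move=> pm qm ps qs pq.
pose f v := q (sval (cid (ps v))).
have fE u : f (p u) = q u.
  rewrite /f; case: cid => u' /= pu'; apply/eqP; rewrite -subr_eq0 -linearB.
  by rewrite pq // linearB /= pu' subrr.
have flin : linear f.
  move=> a v v'; have [[u <-] [u' <-]] := conj (ps v) (ps v').
  by rewrite -linearP !fE linearP.
pose F : {linear V -> W} := HB.pack f (GRing.isLinear.Build K V W *:%R f flin).
exists F; split=> [x v|w].
  by have [u <-] := ps v; rewrite -pm /= !fE qm.
by have [u <-] := qs w; exists (p u); rewrite /= fE.
Qed.

End LieModules.

(** * Strings in sl(2)-modules *)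

Section IterLinear.
Context (K : fieldType) (V : lmodType K) (f : {linear V -> V}).

Lemma iter_lin0 n : iter n f 0 = 0.
Proof. by elim: n => //= n ->; rewrite linear0. Qed.

Lemma iter_linP n a x y : iter n f (a *: x + y) = a *: iter n f x + iter n f y.
Proof. by elim: n => //= n ->; rewrite linearP. Qed.

Lemma iter_linD n x y : iter n f (x + y) = iter n f x + iter n f y.
Proof. by rewrite -[x]scale1r iter_linP !scale1r. Qed.

End IterLinear.

Section SL2.
Context (K : fieldType) (char0 : forall n : nat, n.+1%:R != 0 :> K).
(** Keeping the weights as a family of predicates makes the situation
    symmetric: exchanging [e] and [f] amounts to negating [c]. *)
Context (V : lmodType K) (e f : {linear V -> V}) (wgt : K -> V -> Prop).
Hypothesis wgt_e : forall c x, wgt c x -> wgt (c + 2%:R) (e x).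
Hypothesis wgt_f : forall c x, wgt c x -> wgt (c - 2%:R) (f x).
Hypothesis comm_ef : forall c x, wgt c x -> e (f x) = f (e x) + c *: x.

Lemma wgt_iterf n c x : wgt c x -> wgt (c - (n * 2)%:R) (iter n f x).
Proof.
move=> wx; elim: n => [|n IH]; first by rewrite subr0.
by rewrite mulSn addnC natrD opprD addrA; exact: wgt_f.
Qed.

Lemma e_iterf n c x : wgt c x ->
  e (iter n.+1 f x) = iter n.+1 f (e x) + (n.+1%:R * (c - n%:R)) *: iter n f x.
Proof.
move=> wx; elim: n => [|n IH].
  by rewrite /= (comm_ef wx) mul1r subr0.
rewrite iterS (comm_ef (wgt_iterf n.+1 wx)) {}IH linearD linearZ /= -addrA.
congr (_ + _); rewrite -scalerDl; congr (_ *: _).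
rewrite natrM -!natr1; ring.
Qed.

(** On a singular vector, e f ^ n = n (c - n + 1) f ^ (n - 1), so the first
    power of f that kills it determines c. *)
Lemma singular_string n c x : wgt c x -> e x = 0 -> x != 0 -> iter n f x = 0 ->
  exists2 m, (m < n)%N & c = m%:R.
Proof.
move=> wx ex x0; elim: n => [/= /eqP|n IH fx]; first by rewrite (negPf x0).
have := e_iterf n wx; rewrite ex iter_lin0 add0r fx linear0 => /esym/eqP.
rewrite scaler_eq0 mulf_eq0 (negPf (char0 n)) /= => /orP[|/eqP/IH[m mn cm]].
  by rewrite subr_eq0 => /eqP ->; exists n.
by exists m => //; exact: leqW.
Qed.

(** The operator f ^ m is injective on a vector x of weight m on which e is
    nilpotent. The induction, on the order of nilpotency, raises the weight:
    if f ^ m kills x then f ^ (m + 2) kills e x, because the correction term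
    of [e_iterf] for the power m + 2 is a multiple of f ^ (m + 1) x. So e x =
    0, and a singular vector of weight m survives f ^ m. *)
Lemma string_descent m k x :
  wgt m%:R x -> iter k e x = 0 -> iter m f x = 0 -> x = 0.
Proof.
elim: k m x => [//|k IH] m x wx ekx fx.
have ex : e x = 0.
  apply: (IH m.+2); first by rewrite -addn2 natrD; exact: wgt_e.
    by rewrite -iterSr.
  have := e_iterf m.+1 wx.
  have -> : iter m.+2 f x = 0 by rewrite -addn2 addnC iterD fx iter_lin0.
  have -> : iter m.+1 f x = 0 by rewrite iterS fx linear0.
  by rewrite linear0 scaler0 addr0.
apply/eqP/negPn/negP => x0.
have [p pm /eqP] := singular_string wx ex x0 fx.
rewrite -subr_eq0 -natrB ?(ltnW pm) //.
by case: (m - p)%N (subn_gt0 p m) => [|q _]; rewrite ?pm // (negPf (char0 q)).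
Qed.

End SL2.

(** * Locally nilpotent actions *)

Section Nilpotent.
Context (K : fieldType) (g : lieAlgType K) (V : lieModType g).

Lemma lact_comm (x y : g) (u : V) : lact x (lact y u) = lact [lie x, y] u + lact y (lact x u).
Proof. by rewrite lact_lie subrK. Qed.

(** Asking for nilpotency modulo a submodule, rather than nilpotency, lets the
    construction be iterated over several commuting operators. *)
Definition nil_mod (z : g) (B : set V) : set V :=
  [set u | exists n, B (iter n (lact z) u)]%classic.

Lemma submod_iter (B : set V) (z : g) n u : submod B -> B u -> B (iter n (lact z) u).
Proof. by move=> sB Bu; elim: n => //= n; exact: sB.2. Qed.

(** By the Leibniz rule, each of the [m + n] factors [z] falls either on [y]
    or on [u]. *)
Lemma leibniz_nil (z y : g) (B : set V) m n u : submod B ->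
  iter m (lie z) y = 0 -> B (iter n (lact z) u) ->
  B (iter (m + n) (lact z) (lact y u)).
Proof.
move=> sB; have [s ms] := ubnP (m + n); elim: s m n y u ms => // s IH m n y u.
case: m => [|m] ms; first by move=> /= -> _; rewrite lact0l iter_lin0; case: sB.1.
case: n ms => [|n] ms ady Bu.
  by apply: submod_iter => //; exact: sB.2.
rewrite addSn iterSr lact_comm iter_linD; apply: (subspace_add sB.1).
  by apply: IH; [move: ms; lia | rewrite -?iterSr | rewrite -?iterSr].
by rewrite addnS -addSn; apply: IH; [move: ms; lia | rewrite -?iterSr | rewrite -?iterSr].
Qed.

Lemma nil_mod_subspace (z : g) (B : set V) : submod B -> subspace (nil_mod z B).
Proof.
move=> sB; split; first by exists 0%N; case: sB.1.
move=> a u v [m Bu] [n Bv]; exists (m + n)%N; rewrite iter_linP.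
apply: sB.1.2; first by rewrite addnC iterD; exact: submod_iter.
by rewrite iterD; exact: submod_iter.
Qed.

End Nilpotent.

(** * Chevalley generators *)

Section Generators.
Context (K : fieldType) (I : finType) (A : I -> I -> int) (rz : realization K A).
Context (hA : generalized_cartan A) (g : kac_moody rz).
Local Notation h := (cartan rz).
Local Notation alpha := (Defs.root rz).
Local Notation E := (km_e g).
Local Notation F := (km_f g).
Local Notation H := (km_h g).

Local Notation cl t := (km_proj g (km_cls t)).

Lemma cl_lie (s t : km_term rz) : [lie cl s, cl t] = cl (KmLie s t).
Proof. by rewrite -km_proj_lie; congr (km_proj g _); exact: km_lieE. Qed.

Lemma cl_rel (s t : km_term rz) : km_rel s t -> cl s = cl t.
Proof. by move=> st; congr (km_proj g _); exact: km_cls_rel. Qed.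

Lemma lie_HH x y : [lie H x, H y] = 0.
Proof. by rewrite cl_lie (cl_rel (kr_HH _ _)) km_cls0 linear0. Qed.

Lemma lie_HE x i : [lie H x, E i] = (alpha i x : K) *: E i.
Proof. by rewrite cl_lie (cl_rel (kr_HE _ _)) km_clsZ linearZ. Qed.

Lemma lie_HF x i : [lie H x, F i] = (- alpha i x : K) *: F i.
Proof. by rewrite cl_lie (cl_rel (kr_HF _ _)) km_clsZ linearZ. Qed.

Lemma lie_EF i j : [lie E i, F j] = if i == j then H (coroot rz i) else 0.
Proof.
rewrite cl_lie (cl_rel (kr_EF _ _ _)); case: eqP => // _.
by rewrite km_cls0 linear0.
Qed.

Lemma lieC (x y : g) : [lie x, y] = - [lie y, x].
Proof.
apply/eqP; rewrite -addr_eq0; apply/eqP.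
have lD u v w : [lie (u + v : g), w] = [lie u, w] + [lie v, w].
  by rewrite -[u]scale1r lie_linearl !scale1r.
have rD u v w : [lie w, (u + v : g)] = [lie w, u] + [lie w, v].
  by rewrite -[u]scale1r lie_linearr !scale1r.
by have := liexx (x + y); rewrite lD !rD !liexx add0r addr0.
Qed.

Lemma iter_cl_lie n (s t : km_term rz) :
  iter n (lie (cl s)) (cl t) = cl (iter n (KmLie s) t).
Proof. by elim: n => //= n ->; exact: cl_lie. Qed.

Lemma serre_E i j : exists m, iter m (lie (E i)) (E j) = 0.
Proof.
have [<-|ij] := eqVneq i j; first by exists 1%N; rewrite /= liexx.
exists `|1 - A i j|%N.
by rewrite iter_cl_lie (cl_rel (kr_serreE _ ij)) km_cls0 linear0.
Qed.

Lemma serre_F i j : i != j -> iter `|1 - A i j|%N (lie (F i)) (F j) = 0.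
Proof. by move=> ij; rewrite iter_cl_lie (cl_rel (kr_serreF _ ij)) km_cls0 linear0. Qed.

Lemma lie_FF i j : A i j = 0 -> [lie F i, F j] = 0.
Proof.
have [<- _|ij Aij] := eqVneq i j; first exact: liexx.
by have := serre_F ij; rewrite Aij subr0.
Qed.

Lemma ad_nil_E i (P := fun y : g => exists m, iter m (lie (E i)) y = 0) :
  [/\ forall x, P (H x), forall j, P (E j) & forall j, P (F j)].
Proof.
have PH x : iter 2 (lie (E i)) (H x) = 0.
  by rewrite /= (lieC (E i) (H x)) lie_HE -scaleNr linearZ /= liexx scaler0.
split=> [x|j|j]; [by exists 2 | exact: serre_E | exists 3].
rewrite -[3]/(2 + 1)%N iterD {2}/iter /= lie_EF; case: eqP => _; last by rewrite !linear0.
exact: PH.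
Qed.

Lemma ad_nil_F i (P := fun y : g => exists m, iter m (lie (F i)) y = 0) :
  [/\ forall x, P (H x), forall j, P (E j) & forall j, P (F j)].
Proof.
have PH x : iter 2 (lie (F i)) (H x) = 0.
  by rewrite /= (lieC (F i) (H x)) lie_HF -scaleNr linearZ /= liexx scaler0.
split=> [x|j|j]; first by exists 2.
  exists 3; rewrite -[3]/(2 + 1)%N iterD {2}/iter /= (lieC (F i) (E j)) lie_EF.
  case: eqP => _; last by rewrite oppr0 !linear0.
  by rewrite !linearN; apply: etrans (congr1 -%R (PH _)) (oppr0 _).
have [<-|ij] := eqVneq i j; first by exists 1%N; rewrite /= liexx.
by exists `|1 - A i j|%N; exact: serre_F.
Qed.

(** The elements of g that preserve [P] form a Lie subalgebra, and g is
    generated by the Cartan subalgebra and the Chevalley generators. *)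
Lemma generators_submod (V : lieModType g) (P : set V) : subspace P ->
  (forall x u, P u -> P (lact (H x) u)) -> (forall i u, P u -> P (lact (E i) u)) ->
  (forall i u, P u -> P (lact (F i) u)) -> submod P.
Proof.
move=> sP PH PE PF; split=> // x u Pu; have [y <-] := km_proj_surj x.
have [t ->] := km_cls_surj y; elim: t u Pu {x y} => [x|i|i||s IHs t IHt|s IHs|a s IHs|s IHs t IHt] u Pu.
- exact: PH.
- exact: PE.
- exact: PF.
- by rewrite km_cls0 linear0 lact0l; case: sP.
- by rewrite km_clsD linearD lactDl; apply: subspace_add; auto.
- by rewrite km_clsN linearN lactNl; apply: subspace_opp; auto.
- by rewrite km_clsZ linearZ lactZl; apply: subspace_scale; auto.
- by rewrite -cl_lie lact_lie; apply: subspace_add => //; [auto|apply: subspace_opp; auto].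
Qed.

Lemma nil_mod_submod (V : lieModType g) (z : g) (B : set V)
    (P := fun y : g => exists m, iter m (lie z) y = 0) :
  [/\ forall x, P (H x), forall j, P (E j) & forall j, P (F j)] ->
  submod B -> submod (nil_mod z B).
Proof.
move=> [PH PE PF] sB; apply: generators_submod; first exact: nil_mod_subspace.
- by move=> x u [n Bu]; have [m zx] := PH x; exists (m + n)%N; exact: leibniz_nil.
- by move=> i u [n Bu]; have [m zx] := PE i; exists (m + n)%N; exact: leibniz_nil.
- by move=> i u [n Bu]; have [m zx] := PF i; exists (m + n)%N; exact: leibniz_nil.
Qed.

End Generators.

(** * Weights *)

Section Weights.
Context (K : fieldType) (char0 : forall n : nat, n.+1%:R != 0 :> K).
Context (I : finType) (A : I -> I -> int) (rz : realization K A).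
Context (hA : generalized_cartan A) (g : kac_moody rz).
Local Notation h := (cartan rz).
Local Notation alpha := (Defs.root rz).
Local Notation E := (km_e g).
Local Notation F := (km_f g).
Local Notation H := (km_h g).

Section OneModule.
Context (V : lieModType g).
Implicit Types (mu : dual h) (u v : V) (N : set V).

Lemma weight_E mu i u : weight_space mu u -> weight_space (mu + alpha i) (lact (E i) u).
Proof.
move=> wu x; rewrite lact_comm lie_HE lactZl wu lactZr -scalerDl add_lfunE.
by rewrite addrC.
Qed.

Lemma weight_F mu i u : weight_space mu u -> weight_space (mu - alpha i) (lact (F i) u).
Proof.
move=> wu x; rewrite lact_comm lie_HF lactZl wu lactZr -scalerDl add_lfunE opp_lfunE.
by rewrite addrC.
Qed.

Lemma weight_iter_E mu i n u :
  weight_space mu u -> weight_space (mu + alpha i *+ n) (iter n (lact (E i)) u).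
Proof.
move=> wu; elim: n => [|n IH]; first by rewrite addr0.
by rewrite mulrSr addrA; exact: weight_E.
Qed.

Lemma weight_iter_F mu i n u :
  weight_space mu u -> weight_space (mu - alpha i *+ n) (iter n (lact (F i)) u).
Proof.
move=> wu; elim: n => [|n IH]; first by rewrite subr0.
by rewrite mulrSr opprD addrA; exact: weight_F.
Qed.

(** The product of the operators [x - c] for the pairs [(x, c)] in [s]. *)
Definition shift (s : seq (h * K)) u : V :=
  foldr (fun p u => lact (H p.1) u - p.2 *: u) u s.

(** The complement of the weight space of [mu] formed by the other weight
    spaces, described without any direct sum: a vector has no component of
    weight [mu] when it is killed by a product of operators x - c, with x in
    the Cartan subalgebra, none of which vanishes on weight [mu]. *)
Definition off_weight mu : set V := [set u | exists2 s : seq (h * K),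
  all (fun p => p.2 != mu p.1) s & shift s u = 0]%classic.

Lemma shift_linear s a u v : shift s (a *: u + v) = a *: shift s u + shift s v.
Proof.
elim: s => //= p s ->; rewrite linearP scalerDr !scalerA [p.2 * a]mulrC -scalerA.
by rewrite scalerBr opprD addrACA.
Qed.

Lemma shift0 s : shift s 0 = 0.
Proof. by elim: s => //= p s ->; rewrite linear0 scaler0 subr0. Qed.

Lemma lact_HH x y u : lact (H x) (lact (H y) u) = lact (H y) (lact (H x) u).
Proof. by rewrite lact_comm lie_HH lact0l add0r. Qed.

Lemma shift_H s x u : shift s (lact (H x) u) = lact (H x) (shift s u).
Proof. by elim: s => //= p s ->; rewrite linearB /= lactZr lact_HH. Qed.

Lemma shiftC s t u : shift s (shift t u) = shift t (shift s u).
Proof.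
elim: s => //= p s ->; rewrite -shift_H -scaleNr addrC -shift_linear.
by rewrite addrC scaleNr.
Qed.

Lemma shift_weight mu s u : weight_space mu u ->
  shift s u = (\prod_(p <- s) ((mu p.1 : K) - p.2)) *: u.
Proof.
move=> wu; elim: s => [|p s IH] /=; first by rewrite big_nil scale1r.
rewrite big_cons {}IH lactZr wu !scalerA -scalerBl; congr (_ *: _).
by rewrite mulrBl [_ * mu p.1]mulrC.
Qed.

Lemma shift_cat s t u : shift (s ++ t) u = shift s (shift t u).
Proof. exact: foldr_cat. Qed.

Lemma off_weight_subspace mu : subspace (off_weight mu).
Proof.
split; first by exists [::].
move=> a u v [s sP us] [t tP vt]; exists (s ++ t); first by rewrite all_cat sP tP.
rewrite shift_cat shift_linear vt addr0 -[a *: _]addr0 shift_linear shiftC us.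
by rewrite !shift0 scaler0 addr0.
Qed.

Lemma dual_neq mu nu : mu <> nu -> exists x : h, mu x != nu x.
Proof.
move=> munu; apply/not_existsP => H0; apply: munu; apply/lfunP => x.
by have /negP/negPn/eqP := H0 x.
Qed.

Lemma off_weight_other mu nu u : weight_space nu u -> nu <> mu -> off_weight mu u.
Proof.
move=> wu /dual_neq[x nx]; exists [:: (x, nu x)]; first by rewrite /= nx.
by rewrite /= wu subrr.
Qed.

Lemma submod_shift N s u : submod N -> N u -> N (shift s u).
Proof.
move=> sN Nu; elim: s => //= p s IH; rewrite -scaleNr addrC.
by apply: sN.1.2 => //; exact: sN.2.
Qed.

(** Submodules are homogeneous: the product of shifts that kills [v]
    multiplies [u] by a nonzero scalar. *)
Lemma submod_component mu N u v : submod N -> weight_space mu u -> off_weight mu v ->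
  N (u + v) -> N u.
Proof.
move=> sN wu [s sP vs] /(submod_shift s sN).
rewrite -[u]scale1r shift_linear vs addr0 !scale1r (shift_weight s wu).
set c := \prod_(p <- s) _ => Nu.
have c0 : c != 0.
  rewrite prodf_seq_neq0; apply/allP => p ps; rewrite subr_eq0 eq_sym.
  exact: (allP sP).
by rewrite -[u](scalerK c0); apply: subspace_scale Nu; exact: sN.1.
Qed.

Lemma off_weight_disjoint mu u : weight_space mu u -> off_weight mu u -> u = 0.
Proof.
move=> wu ou; apply: (submod_component (@submod0 K g V) wu (v := - u)).
  by apply: subspace_opp ou; exact: off_weight_subspace.
by rewrite /= subrr.
Qed.

Lemma alpha_coroot i : alpha i (coroot rz i) = 2%:R :> K.
Proof. by case: hA => A2 _ _; rewrite root_coroot A2. Qed.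

Let wgt i (c : K) u := lact (H (coroot rz i)) u = c *: u.

Let wgt_E i c u : wgt i c u -> wgt i (c + 2%:R) (lact (E i) u).
Proof.
by rewrite /wgt => wu; rewrite lact_comm lie_HE alpha_coroot lactZl wu lactZr -scalerDl addrC.
Qed.

Let wgt_F i c u : wgt i c u -> wgt i (c - 2%:R) (lact (F i) u).
Proof.
by rewrite /wgt => wu; rewrite lact_comm lie_HF alpha_coroot lactZl wu lactZr -scalerDl addrC.
Qed.

Let comm_EF i c u : wgt i c u ->
  lact (E i) (lact (F i) u) = lact (F i) (lact (E i) u) + c *: u.
Proof. by rewrite /wgt => wu; rewrite lact_comm lie_EF eqxx wu addrC. Qed.

Lemma singular_string_F mu i n u : weight_space mu u -> lact (E i) u = 0 -> u != 0 ->
  iter n (lact (F i)) u = 0 -> exists m, mu (coroot rz i) = m%:R :> K.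
Proof.
move=> wu Eu u0 Fu.
have [m _ ->] := singular_string char0 (@wgt_F i) (@comm_EF i) (wu _) Eu u0 Fu.
by exists m.
Qed.

Lemma singular_next mu i m u : weight_space mu u -> lact (E i) u = 0 ->
  mu (coroot rz i) = m%:R :> K -> lact (E i) (iter m.+1 (lact (F i)) u) = 0.
Proof.
move=> wu Eu mum; have := e_iterf (@wgt_F i) (@comm_EF i) m (wu _).
by rewrite /= Eu iter_lin0 linear0 mum subrr mulr0 scale0r addr0.
Qed.

(** The sl(2)-string of a vector of nonnegative weight m has at least m
    further steps downwards. *)
Lemma string_down mu i m n u : weight_space mu u -> mu (coroot rz i) = m%:R :> K ->
  (n <= m)%N -> (exists k, iter k (lact (E i)) u = 0) -> u != 0 ->
  iter n (lact (F i)) u != 0.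
Proof.
move=> wu mum nm [k Eu]; apply: contra => /eqP Fu; apply/eqP.
apply: (string_descent char0 (@wgt_E i) (@wgt_F i) (@comm_EF i) _ Eu (m := m)).
  by rewrite /wgt wu mum.
by rewrite -(subnK nm) iterD Fu iter_lin0.
Qed.

(** The statement of [string_descent] with the roles of E and F exchanged: a
    vector of weight -p on which F is nilpotent lies on a string that reaches
    weight p. *)
Lemma string_up mu i p k u : weight_space mu u -> mu (coroot rz i) = - p%:R :> K ->
  iter k (lact (F i)) u = 0 -> iter p (lact (E i)) u = 0 -> u = 0.
Proof.
move=> wu mup Fu Eu; pose wgt' c := wgt i (- c).
apply: (@string_descent _ char0 _ (lact (F i)) (lact (E i)) wgt' _ _ _ p k) => //.
- by move=> c x wx; rewrite /wgt' opprD; exact: wgt_F.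
- by move=> c x wx; rewrite /wgt' opprD opprK; exact: wgt_E.
- by move=> c x wx; rewrite /= (comm_EF wx) -addrA -scalerDl addNr scale0r addr0.
- by rewrite /wgt' /wgt wu mup.
Qed.

End OneModule.

Lemma weight_morph (V W : lieModType g) (f : {linear V -> W}) mu u :
  lmod_morphism f -> weight_space mu u -> weight_space mu (f u).
Proof. by move=> fm wu x; rewrite -fm wu linearZ. Qed.

Lemma off_weight_morph (V W : lieModType g) (f : {linear V -> W}) mu u :
  lmod_morphism f -> off_weight mu u -> off_weight mu (f u).
Proof.
move=> fm [s sP us]; exists s => //.
have -> : shift s (f u) = f (shift s u).
  by elim: s {sP us} => //= p s ->; rewrite linearB /= fm; congr (_ - _); rewrite linearZ.
by rewrite us linear0.
Qed.

End Weights.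

(** * Highest weight modules and words in the lowering operators *)

Section HighestWeight.
Context (K : fieldType) (char0 : forall n : nat, n.+1%:R != 0 :> K).
Context (I : finType) (A : I -> I -> int) (rz : realization K A).
Context (hA : generalized_cartan A) (g : kac_moody rz).
Local Notation h := (cartan rz).
Local Notation alpha := (Defs.root rz).
Local Notation E := (km_e g).
Local Notation F := (km_f g).
Local Notation H := (km_h g).
Context (lam : dual h).

Definition content (w : seq I) (i : I) : nat := count_mem i w.

Definition lowered (k : I -> nat) : dual h := lam - \sum_i alpha i *+ k i.

Definition fword (V : lieModType g) (w : seq I) (v : V) : V :=
  foldr (fun i => lact (F i)) v w.

Definition highest_weight (V : lieModType g) (v : V) : Prop :=
  [/\ weight_space lam v, (forall i, lact (E i) v = 0)
    & forall N : set V, submod N -> N v -> forall u, N u].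

Lemma sum_incr (k k' : I -> nat) i n : (forall j, k' j = (k j + n * (j == i))%N) ->
  \sum_j alpha j *+ k' j = \sum_j alpha j *+ k j + alpha i *+ n.
Proof.
move=> kk'; rewrite (eq_bigr (fun j => alpha j *+ k j + alpha j *+ (n * (j == i)))); last first.
  by move=> j _; rewrite kk' mulrnDr.
rewrite big_split /=; congr (_ + _); rewrite (bigD1 i) //= eqxx muln1 big1 ?addr0 //.
by move=> j /negPf ->; rewrite muln0.
Qed.

Lemma lowered_incr (k k' : I -> nat) i n : (forall j, k' j = (k j + n * (j == i))%N) ->
  lowered k' = lowered k - alpha i *+ n.
Proof. by move=> kk'; rewrite /lowered (sum_incr kk') opprD addrA. Qed.

Lemma char0_natr_eq0 n : (n%:R == 0 :> K) = (n == 0%N).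
Proof. by case: n => [|n]; rewrite ?eqxx // (negPf (char0 n)). Qed.

Lemma char0_natr_inj m n : m%:R = n%:R :> K -> m = n.
Proof.
wlog mn : m n / (m <= n)%N.
  by move=> IH; have [/IH//|/ltnW/IH nm /esym/nm] := leqP m n.
move=> /esym/eqP; rewrite -subr_eq0 -natrB // char0_natr_eq0 subn_eq0 => nm.
by apply/eqP; rewrite eqn_leq mn.
Qed.

Lemma alpha_free (c : I -> K) : \sum_i c i *: alpha i = 0 -> forall i, c i = 0.
Proof.
move=> c0 i; have := root_free rz; set s := [seq _ | _ <- _] => fs.
have szs : size s == #|I| by rewrite size_map -cardE.
have /freeP/(_ (fun j => c (enum_val j))) H0 : free (Tuple szs) by [].
rewrite -(enum_rankK i); apply: H0.
rewrite -[RHS]c0 (reindex (@enum_val I I)) /=; last first.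
  by exists enum_rank => j _; [exact: enum_valK | exact: enum_rankK].
apply: eq_bigr => j _; congr (_ *: _).
rewrite (nth_map (enum_val j)) ?size_enum_ord -?cardE //.
by rewrite -enum_val_nth.
Qed.

(** The simple roots are linearly independent and the field has characteristic
    zero. *)
Lemma lowered_inj k k' : lowered k = lowered k' -> k = k'.
Proof.
move=> /addrI/oppr_inj/eqP; rewrite -subr_eq0 -sumrB => /eqP s0.
apply/funext => i; apply/char0_natr_inj/eqP; rewrite -subr_eq0; apply/eqP.
apply: (alpha_free (c := fun i => (k i)%:R - (k' i)%:R)).
by rewrite -[RHS]s0; apply: eq_bigr => j _; rewrite scalerBl !scaler_nat.
Qed.

Lemma lowered0 : lowered (fun=> 0%N) = lam.
Proof. by rewrite /lowered big1 ?subr0. Qed.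

Lemma lowered_coroot k i :
  lowered k (coroot rz i) = lam (coroot rz i) - (\sum_j A i j * (k j)%:Z)%:~R :> K.
Proof.
rewrite /lowered add_lfunE opp_lfunE sum_lfunE; congr (_ - _).
rewrite rmorph_sum; apply: eq_bigr => j _.
by rewrite -scaler_nat scale_lfunE root_coroot rmorphM /= mulrC.
Qed.

Section Words.
Context (V : lieModType g).
Implicit Types (u v : V) (N : set V) (w : seq I).

Lemma fword_cat w w' v : fword (w ++ w') v = fword w (fword w' v).
Proof. exact: foldr_cat. Qed.

Lemma fword_nseq n i v : fword (nseq n i) v = iter n (lact (F i)) v.
Proof. by elim: n => //= n ->. Qed.

Lemma fword0 w : fword w (0 : V) = 0.
Proof. by elim: w => //= i w ->; rewrite linear0. Qed.

Lemma lact_FF i j v : A i j = 0 \/ i = j ->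
  lact (F i) (lact (F j) v) = lact (F j) (lact (F i) v).
Proof. by case=> [Aij|-> //]; rewrite lact_comm lie_FF // lact0l add0r. Qed.

Definition commuting w := {in w &, forall i j, A i j = 0 \/ i = j}.

Lemma lact_F_fword i w v : {in w, forall j, A i j = 0 \/ i = j} ->
  lact (F i) (fword w v) = fword w (lact (F i) v).
Proof.
elim: w => //= j w IH cw; rewrite lact_FF; last by apply: cw; rewrite inE eqxx.
by rewrite IH // => a aw; apply: cw; rewrite inE aw orbT.
Qed.

Lemma fword_perm w w' v : commuting w -> perm_eq w w' -> fword w v = fword w' v.
Proof.
elim: w w' => [|i w IH] w' cw; first by move=> /perm_size/esym/size0nil ->.
move=> ww'; have iw' : i \in w' by rewrite -(perm_mem ww') inE eqxx.
case/splitPr: iw' ww' => p q; rewrite -[i :: q]cat1s perm_sym perm_catCA /= perm_cons perm_sym => wpq.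
have cp : {in p, forall j, A i j = 0 \/ i = j}.
  by move=> j jp; apply: cw; rewrite !inE ?eqxx // (perm_mem wpq) mem_cat jp orbT.
rewrite /= (IH (p ++ q)) //; last first.
  by apply: sub_in2 cw => a; rewrite inE orbC => ->.
by rewrite !fword_cat /= (lact_F_fword _ cp).
Qed.

Lemma perm_content w w' : content w = content w' -> perm_eq w w'.
Proof.
by move=> cc; apply/allP => i _ /=; apply/eqP; exact: (congr1 (@^~ i) cc).
Qed.

Lemma content_cons i w j : content (i :: w) j = (content w j + 1 * (j == i))%N.
Proof. by rewrite /content /= addnC eq_sym mul1n. Qed.

Lemma fword_weight v w : weight_space lam v -> weight_space (lowered (content w)) (fword w v).
Proof.
move=> wv; elim: w => [|i w IH]; first by rewrite /content /= lowered0.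
by rewrite (lowered_incr (content_cons i w)); exact: weight_F.
Qed.

Section HW.
Context (v : V) (hv : highest_weight v).

(** A highest weight module is spanned by the words applied to its highest
    weight vector: the span is stable under F, and moving an E to the right
    through a word only creates elements of the Cartan subalgebra, which act
    by scalars on words. *)
Lemma word_ind N : subspace N -> (forall w, N (fword w v)) -> forall u, N u.
Proof.
pose P : set V := [set u | forall N, subspace N -> (forall w, N (fword w v)) -> N u]%classic.
have sP : subspace P.
  split; first by move=> M [].
  by move=> a x y Px Py M sM Mw; apply: sM.2; [exact: Px | exact: Py].
have PF i u : P u -> P (lact (F i) u).
  move=> Pu M sM Mw; apply: (Pu (fun x => M (lact (F i) x))).
    by split=> [|a x y Mx My]; rewrite ?linear0 ?linearP; case: sM => // M0 MP; exact: MP.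
  by move=> w; exact: (Mw (i :: w)).
have Pw w : P (fword w v) by move=> M sM.
have [wv Ev genv] := hv.
have sub Q : (forall w, P (Q (fword w v))) -> linear Q -> forall u, P u -> P (Q u).
  move=> PQ linQ u Pu M sM Mw; apply: (Pu (fun x => M (Q x))).
    split=> [|a x y Mx My]; last by rewrite linQ; exact: sM.2.
    have -> : Q 0 = 0.
      by have := linQ (-1) 0 0; rewrite scaleN1r oppr0 addr0 scaleN1r addNr.
    by case: sM.
  by move=> w; exact: (PQ w).
suff PP : submod P by move=> sN Nw u; apply: (genv _ PP (Pw [::]) u).
apply: generators_submod => //.
  move=> x; apply: (sub (lact (H x))); last by move=> a p q; exact: lact_linearr.
  move=> w; rewrite (fword_weight w wv); exact: (subspace_scale _ sP (Pw _)).
move=> i; apply: (sub (lact (E i))); last by move=> a p q; exact: lact_linearr.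
elim=> [|j w IH] /=; first by rewrite Ev; case: sP.
rewrite lact_comm lie_EF; apply: (subspace_add sP); last exact: PF.
case: eqP => _; last by rewrite lact0l; case: sP.
by rewrite (fword_weight w wv); exact: (subspace_scale _ sP (Pw _)).
Qed.

Lemma weight_word mu u : weight_space mu u -> u != 0 ->
  exists2 w, mu = lowered (content w) & fword w v != 0.
Proof.
move=> wu; apply: contra_neqP => nw; apply: (off_weight_disjoint wu).
apply: word_ind; first exact: off_weight_subspace.
move=> w; have [->|fw0] := eqVneq (fword w v) 0.
  by case: (@off_weight_subspace _ _ _ _ g V mu).
apply: (@off_weight_other _ _ _ _ _ _ _ (lowered (content w))).
  by apply: fword_weight; case: hv.
by move=> wmu; apply: nw; exists w.
Qed.

Lemma weight_split mu u : exists x y, [/\ weight_space mu x, off_weight mu y & u = x + y].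
Proof.
apply: (word_ind (N := fun u => exists x y, [/\ weight_space mu x, off_weight mu y & u = x + y])).
  split.
    exists 0, 0; split; [by move=> x; rewrite linear0 scaler0 | | by rewrite addr0].
    by case: (@off_weight_subspace _ _ _ _ g V mu).
  move=> a _ _ [x [y [wx oy ->]]] [x' [y' [wx' oy' ->]]].
  exists (a *: x + x'), (a *: y + y'); split; last by rewrite scalerDr addrACA.
    move=> z; rewrite lact_linearr wx wx' !scalerDr !scalerA; congr (_ *: _ + _); exact: mulrC.
  exact: (@off_weight_subspace _ _ _ _ g V mu).2.
move=> w; have wv : weight_space lam v by case: hv.
have [wmu|wmu] := eqVneq mu (lowered (content w)).
  exists (fword w v), 0; split; [by rewrite wmu; exact: fword_weight | | by rewrite addr0].
  by case: (@off_weight_subspace _ _ _ _ g V mu).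
exists 0, (fword w v); split; [by move=> x; rewrite linear0 scaler0 | | by rewrite add0r].
by apply: (off_weight_other (fword_weight w wv)) => /esym/eqP; apply/negP.
Qed.

(** When the letters of [w] commute, all words with the same content act in
    the same way, so the weight space of [fword w v] is spanned by this
    vector. *)
Lemma commuting_weight w u : commuting w ->
  exists c y, off_weight (lowered (content w)) y /\ u = c *: fword w v + y.
Proof.
move=> cw; set mu := lowered _; have sO := @off_weight_subspace _ _ _ _ g V mu.
apply: (word_ind (N := fun u => exists c y, off_weight mu y /\ u = c *: fword w v + y)).
  split; first by exists 0, 0; split; [case: sO | rewrite scale0r addr0].
  move=> a _ _ [c [y [oy ->]]] [c' [y' [oy' ->]]].
  exists (a * c + c'), (a *: y + y'); split; first exact: sO.2.
  by rewrite scalerDr scalerA addrACA scalerDl.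
move=> w'; have [/esym/perm_content ww'|ww'] := pselect (content w' = content w).
  by exists 1, 0; split; [case: sO | rewrite scale1r addr0 (fword_perm v cw ww')].
exists 0, (fword w' v); split; last by rewrite scale0r add0r.
by apply: off_weight_other (fword_weight w' _) _; [case: hv | move/lowered_inj].
Qed.

Lemma E_nil i u : exists n, iter n (lact (E i)) u = 0.
Proof.
have [_ Ev genv] := hv.
apply: (genv _ (nil_mod_submod (ad_nil_E g i) (@submod0 _ _ V))).
by exists 1%N; rewrite /= Ev.
Qed.

End HW.
End Words.

Section Morphisms.
Context (V W : lieModType g) (f : {linear V -> W}).
Hypotheses (fm : lmod_morphism f) (fs : forall w, exists v, f v = w).

Lemma fword_morph w (v : V) : f (fword w v) = fword w (f v).
Proof. by elim: w => //= i w <-; rewrite fm. Qed.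

Lemma highest_weight_morph (v : V) : highest_weight v -> highest_weight (f v).
Proof.
move=> [wv Ev genv]; split; first exact: weight_morph.
  by move=> i; rewrite -fm Ev linear0.
move=> N sN Nv u; have [x <-] := fs u.
exact: (genv _ (preim_submod fm sN) Nv x).
Qed.

(** Lift anyhow, then drop the components of the other weights, which map to
    zero. *)
Lemma weight_lift (v : V) mu (y : W) : highest_weight v -> weight_space mu y ->
  exists2 x, weight_space mu x & f x = y.
Proof.
move=> hv wy; have [u fu] := fs y.
have [x [z [wx oz ux]]] := weight_split hv mu u.
exists x => //; apply/eqP; rewrite -subr_eq0; apply/eqP.
apply: (@off_weight_disjoint _ _ _ _ _ _ mu).
  move=> t; rewrite linearB /= wy (weight_morph fm wx) scalerBr //.
have -> : f x - y = - f z by rewrite -fu ux linearD opprD addrA subrr add0r.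
apply: subspace_opp; first exact: off_weight_subspace.
exact: off_weight_morph.
Qed.

Lemma wt_morph (v : V) : highest_weight v -> (wt W `<=` wt V)%classic.
Proof.
move=> hv mu [y wy y0]; have [x wx fx] := weight_lift hv wy.
by exists x => //; apply: contra_neq y0 => x0; rewrite -fx x0 linear0.
Qed.

End Morphisms.

Definition verma_hw : verma g lam := @verma_cls _ _ _ _ g lam (VmHw g).

Lemma verma_highest_weight : highest_weight verma_hw.
Proof.
split.
- move=> x; rewrite /lact /= verma_actE -verma_clsZ; exact/verma_cls_rel/vr_h.
- move=> i; rewrite /lact /= verma_actE; exact/verma_cls_rel/vr_e.
- move=> N sN Nv u; have [t ->] := verma_cls_surj u.
  elim: t {u} => [||s IHs t IHt|s IHs|a s IHs|x s IHs] //.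
  + by case: sN.1.
  + by rewrite verma_clsD; exact: subspace_add sN.1 _ _.
  + by rewrite verma_clsN; exact: subspace_opp sN.1 _.
  + by rewrite verma_clsZ; exact: subspace_scale sN.1 _.
  + by rewrite -verma_actE; exact: sN.2.
Qed.

End HighestWeight.

(** * Combinatorics of generalized Cartan matrices *)

Section Cartan.
Context (I : finType) (A : I -> I -> int) (hA : generalized_cartan A).

Lemma cartan_le0 i j : i != j -> A i j <= 0.
Proof. by case: hA => _ H _; exact: H. Qed.

Lemma cartan_sym0 i j : A i j != 0 -> A j i != 0.
Proof. by case: hA => _ _ H; apply: contra_neq => /H. Qed.

Definition independent (S : {set I}) : Prop :=
  {in S &, forall i j, i != j -> A i j = 0}.

(** The ingredient of Vinberg's classification of Cartan matrices used in the
    descent: let C be the set where u_i / c_i takes its minimal value t. There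
    w = u - t c vanishes while w >= 0 on R, so the off-diagonal signs give (A
    w)_i <= 0, whereas (A w)_i = (A u)_i - t (A c)_i >= 0 by assumption. Hence
    every term vanishes: (A u)_i = 0, and w_j = 0 at each neighbour j of i. *)
Lemma min_ratio (R : {set I}) (u c : I -> int) : R != finset.set0 ->
  (forall i, i \in R -> 0 < c i /\ 0 <= u i) ->
  (forall i, i \in R -> \sum_(j in R) A i j * c j <= 0) ->
  (forall i, i \in R -> 0 <= \sum_(j in R) A i j * u j) ->
  exists C : {set I}, [/\ C != finset.set0, C \subset R &
    forall i, i \in C -> \sum_(j in R) A i j * u j = 0 /\
      forall j, j \in R -> A i j != 0 -> j \in C].
Proof.
move=> /set0Pn[i1 i1R] pos Ac Au.
pose r i : rat := (u i)%:~R / (c i)%:~R.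
have [i0 i0R imin] := @Order.TotalTheory.arg_minP _ rat _ i1 (fun i => i \in R) r i1R.
have [c0 u0] := pos _ i0R.
pose w i := c i0 * u i - u i0 * c i.
have w0 i : i \in R -> 0 <= w i.
  move=> iR; have [ci ui] := pos _ iR; have := imin _ iR; rewrite /r.
  rewrite ler_pdivrMr ?ltr0z // mulrAC ler_pdivlMr ?ltr0z // -!intrM ler_int.
  by rewrite subr_ge0 [c i0 * _]mulrC.
exists [set i in R | w i == 0]; split.
- apply/set0Pn; exists i0; rewrite inE i0R /w mulrC subrr eqxx //.
- by apply/fintype.subsetP => i; rewrite inE => /andP[].
move=> i; rewrite inE => /andP[iR /eqP wi].
have Aw : \sum_(j in R) A i j * w j
    = c i0 * (\sum_(j in R) A i j * u j) - u i0 * (\sum_(j in R) A i j * c j).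
  by rewrite !mulr_sumr -sumrB; apply: eq_bigr => j _; rewrite /w; ring.
have term j : j \in R -> A i j * w j <= 0.
  move=> jR; have [<-|ij] := eqVneq i j; first by rewrite wi mulr0.
  by rewrite mulr_le0_ge0 ?cartan_le0 ?w0.
have Ai := Au _ iR; have Ci := Ac _ iR.
have sumle : \sum_(j in R) A i j * w j <= 0 by exact: sumr_le0.
have p1 : 0 <= c i0 * (\sum_(j in R) A i j * u j) by rewrite mulr_ge0 // ltW.
have p2 : u i0 * (\sum_(j in R) A i j * c j) <= 0 by rewrite mulr_ge0_le0.
have z1 : c i0 * (\sum_(j in R) A i j * u j) = 0 by lia.
have z2 : \sum_(j in R) A i j * w j = 0 by lia.
split; first by move/eqP: z1; rewrite mulf_eq0 gt_eqF //= => /eqP.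
move=> j jR Aij; rewrite inE jR /=.
have : \sum_(j in R) - (A i j * w j) == 0 by rewrite sumrN z2 oppr0.
rewrite psumr_eq0; last by move=> t tR; rewrite oppr_ge0 term.
move/allP/(_ j (mem_index_enum j)); rewrite jR /= oppr_eq0 mulf_eq0 (negPf Aij) //.
Qed.

Lemma sum_offdiag_ge (i h : I) (f : I -> int) : i != h -> A i h != 0 ->
  (forall j, 0 <= f j) -> f i = 0 -> f h <= - \sum_j A i j * f j.
Proof.
move=> ih Aih f0 fi; rewrite (bigD1 h) //= opprD -sumrN -[X in X <= _]addr0.
have Ah : A i h <= -1 by move: (cartan_le0 ih) Aih; lia.
apply: lerD; last first.
  apply: sumr_ge0 => j _; have [<-|ij] := eqVneq i j; first by rewrite fi mulr0 oppr0.
  by rewrite oppr_ge0 mulr_le0_ge0 ?cartan_le0.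
by have := f0 h; nia.
Qed.

Lemma sum_offdiag_ge0 (i : I) (f : I -> int) :
  (forall j, 0 <= f j) -> f i = 0 -> 0 <= - \sum_j A i j * f j.
Proof.
move=> f0 fi; rewrite -sumrN; apply: sumr_ge0 => j _.
have [<-|ij] := eqVneq i j; first by rewrite fi mulr0 oppr0.
by rewrite oppr_ge0 mulr_le0_ge0 ?cartan_le0.
Qed.

End Cartan.

(** * Descent from a hole vector *)

(** In this section [lam i] stands for the value of the highest weight at the
    coroot i, [P] for the set of vertices where it is a natural number, and
    [l] for these numbers; a function [k] stands for the weight obtained by
    subtracting the simple root i exactly [k i] times. *)
Section Descent.
Context (K : fieldType) (char0 : forall n : nat, n.+1%:R != 0 :> K).
Context (I : finType) (A : I -> I -> int) (hA : generalized_cartan A).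
Context (lam : I -> K) (P : pred I) (l : I -> nat).
Hypothesis lamP : forall i, P i -> lam i = (l i)%:R.
Hypothesis lamN : forall i n, ~~ P i -> lam i <> n%:R.

Definition pairing (k : I -> nat) (i : I) : K :=
  lam i - (\sum_j A i j * (k j)%:Z)%:~R.

Definition step (k : I -> nat) (i : I) (n : nat) : I -> nat :=
  fun j => (k j + n * (j == i))%N.

(** The multiplicities subtracted by the commuting simple reflections in [S],
    for the dot action. *)
Definition reflections (S : {set I}) (i : I) : nat := if i \in S then (l i).+1 else 0%N.

(** The properties that will be used of the weights of a module in which the
    hole vector of [S] lies in every nonzero submodule: a lowering operator is
    injective where the weight of the hole vector is not a natural number, and
    sl(2)-strings go down from nonnegative weights. *)
Definition descent_closed (S : {set I}) (X : (I -> nat) -> Prop) : Prop :=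
  [/\ X (reflections S),
      forall i k, (forall m, pairing (reflections S) i <> m%:R) -> X k -> X (step k i 1)
    & forall i k m n, pairing k i = m%:R -> (n <= m)%N -> X k -> X (step k i n)].

Context (k : I -> nat) (S : {set I}).

(** For i in [P] with l_i < k_i, one more than what remains to be subtracted
    at i after the reflection at i. Vertices are treated by decreasing
    [excess]; ties are won by the vertices outside [P], and the remaining ones
    are broken arbitrarily, which [key] encodes in one number. *)
Definition excess i : nat := if P i then (k i - l i)%N else k i.
Definition key i : nat := ((2 * excess i + ~~ P i) * #|I| + enum_rank i)%N.

Lemma key_inj : injective key.
Proof.
move=> i j ij; apply: enum_rank_inj; apply/val_inj.
have := congr1 (modn^~ #|I|) ij.
by rewrite /key !modnMDl !modn_small ?ltn_ord.
Qed.

Lemma key_lt i j : (key i < key j)%N -> (2 * excess i + ~~ P i <= 2 * excess j + ~~ P j)%N.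
Proof.
have I0 : (0 < #|I|)%N by apply/card_gt0P; exists i.
move=> /ltnW/(leq_div2r #|I|).
by rewrite /key !divnMDl // !divn_small ?ltn_ord // !addn0.
Qed.

(** The vertices that need a reflection because the label is too small and no
    neighbour treated earlier raises the pairing. Two adjacent vertices cannot
    both come before the other, so the set is independent. *)
Definition greedy : {set I} := [set i in S | [&& P i, (l i < k i)%N &
  [forall j in S, [&& (0 < k j)%N, j != i & A i j != 0] ==> (key j < key i)%N]]].

Lemma greedyP i : i \in greedy -> [/\ i \in S, P i, (l i < k i)%N &
  forall j, j \in S -> (0 < k j)%N -> j != i -> A i j != 0 -> (key j < key i)%N].
Proof.
rewrite inE => /and4P[iS Pi lk /forallP H]; split=> // j jS kj ji Aij.
by have /implyP/(_ jS)/implyP := H j; apply; rewrite kj ji.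
Qed.

Lemma greedy_independent : independent A greedy.
Proof.
move=> i j /greedyP[iS _ lki iH] /greedyP[jS _ lkj jH] ij; apply/eqP/negPn/negP => Aij.
have := iH j jS (leq_trans (ltn0Sn _) lkj); rewrite eq_sym => /(_ ij Aij).
have := jH i iS (leq_trans (ltn0Sn _) lki) ij (cartan_sym0 hA Aij); lia.
Qed.

Lemma pairing_shift k1 k2 i :
  pairing k2 i = pairing k1 i + (- \sum_j A i j * ((k2 j)%:Z - (k1 j)%:Z))%:~R.
Proof.
rewrite /pairing -addrA; congr (_ + _); rewrite -!rmorphN -rmorphD /= -opprD.
congr ((- _)%:~R); rewrite -big_split /=; apply: eq_bigr => j _; ring.
Qed.

Lemma nonneg_natr (z : int) : 0 <= z -> exists n : nat, z = n%:Z.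
Proof. by case: z => n // _; exists n. Qed.

Lemma closed_step_free X i k1 n : descent_closed greedy X ->
  (forall m, pairing (reflections greedy) i <> m%:R) -> X k1 -> X (step k1 i n).
Proof.
move=> [_ F1 _] fi Xk; elim: n => [|n IH].
  by have -> : step k1 i 0 = k1 by apply/funext => j; rewrite /step addn0.
have -> : step k1 i n.+1 = step (step k1 i n) i 1; last exact: F1.
by apply/funext => j; rewrite /step; lia.
Qed.

(** The progress of the descent: full multiplicity on [T], and the bare
    reflections elsewhere. *)
Let filled (T : {set I}) i : nat := if i \in T then k i else reflections greedy i.

Lemma filled_ge T i : (reflections greedy i <= filled T i)%N.
Proof.
rewrite /filled /reflections; case: (i \in T) => //.
by case: ifP => // iG; have [] := greedyP iG.
Qed.

Lemma reflections_free h m : h \in greedy -> pairing (reflections greedy) h <> m%:R.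
Proof.
move=> hG; have [_ Ph _ _] := greedyP hG.
rewrite /pairing (bigD1 h) //= big1 ?addr0; last first.
  move=> j jh; rewrite /reflections; case: ifP => jG; last by rewrite mulr0.
  by rewrite (greedy_independent hG jG) ?mul0r // eq_sym.
have [A2 _ _] := hA; rewrite /reflections hG A2 lamP // => /eqP.
rewrite -subr_eq0.
have -> : (l h)%:R - (2%:Z * (l h).+1%:Z)%:~R - m%:R = - ((l h + m).+1.+1)%:R :> K by ring.
by rewrite oppr_eq0 (negPf (char0 _)).
Qed.

Lemma fill_step (T : {set I}) i n : i \notin T -> (reflections greedy i + n = k i)%N ->
  step (filled T) i n = filled (i |: T).
Proof.
move=> iT kn; apply/funext => j; rewrite /step /filled !inE.
have [->|ji] /= := eqVneq j i; last by rewrite muln0 addn0.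
by rewrite (negPf iT) muln1.
Qed.

(** If i is in [P], either its label suffices or a neighbour j treated earlier
    contributes k_j, which is at least the excess of i. If i is not in [P],
    the weight of the hole vector at i can only be a natural number m because
    of a neighbour h in the greedy set; then h was treated earlier, with a
    strictly larger excess, and lowering at h from the reflected multiplicity
    to k_h adds to m at least excess h - 1 >= k_i. *)
Lemma greedy_pairing (T : {set I}) i m : greedy \subset T -> i \in S -> i \notin T ->
  (forall j, j \in S -> (key i < key j)%N -> j \in T) ->
  pairing (reflections greedy) i = m%:R ->
  exists2 n, pairing (filled T) i = n%:R & (k i <= n)%N.
Proof.
move=> GT iS iT prev pm.
have iG : i \notin greedy by apply: contra iT => /(fintype.subsetP GT).
have fi : filled T i = 0%N by rewrite /filled /reflections (negPf iT) (negPf iG).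
case Pi : (P i).
  have kl : (k i)%:Z <= (l i)%:Z - \sum_j A i j * (filled T j)%:Z.
    have := sum_offdiag_ge0 hA (i := i) (f := fun j => (filled T j)%:Z) (fun=> isT).
    rewrite fi => /(_ erefl) s0.
    have [lk|lk] := leqP (k i) (l i); first by lia.
    have [j jS [kj ji Aij kij]] : exists2 j, j \in S &
        [/\ (0 < k j)%N, j != i, A i j != 0 & (key i < key j)%N].
      move: iG; rewrite inE iS Pi lk /= => /forallPn[j]; rewrite !negb_imply -leqNgt.
      case/and3P=> jS /and3P[kj ji Aij] kij; exists j => //; split=> //.
      by rewrite ltn_neqAle kij (inj_eq key_inj) eq_sym ji.
    have jT := prev _ jS kij.
    have ij : i != j by rewrite eq_sym.
    have := sum_offdiag_ge hA ij Aij (f := fun j => (filled T j)%:Z) (fun=> isT).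
    rewrite fi /filled jT -/(filled T) => /(_ erefl).
    by have := key_lt kij; rewrite /excess Pi; case: (P j) => /=; lia.
  have [n nE] : exists n : nat, (l i)%:Z - \sum_j A i j * (filled T j)%:Z = n%:Z.
    by apply: nonneg_natr; lia.
  exists n; last by lia.
  by rewrite /pairing lamP // -[(l i)%:R]/((l i)%:Z%:~R) -rmorphB /= nE.
pose d j := (filled T j)%:Z - (reflections greedy j)%:Z.
have d0 j : 0 <= d j by have := filled_ge T j; rewrite /d; lia.
have di : d i = 0 by rewrite /d fi /reflections (negPf iG).
have kd : (k i)%:Z <= m%:Z - \sum_j A i j * d j.
  have s0 := sum_offdiag_ge0 hA d0 di.
  have [ki|ki] := posnP (k i); first by lia.
  have [h hG Aih] : exists2 h, h \in greedy & A i h != 0.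
    apply/not_exists2P => H; apply: (lamN (n := m) (negbT Pi)).
    rewrite -pm /pairing big1 ?subr0 // => j _; rewrite /reflections.
    case: ifP => jG; last by rewrite mulr0.
    by have [//|/negP/negPn/eqP ->] := H j; rewrite mul0r.
  have [hS Ph lh Hh] := greedyP hG.
  have ih : i != h by apply: contraFneq Pi => ->.
  have := key_lt (Hh i iS ki ih (cartan_sym0 hA Aih)); rewrite /excess Pi Ph /=.
  have hT := fintype.subsetP GT _ hG.
  have := sum_offdiag_ge hA ih Aih d0 di; rewrite {1}/d /filled hT /reflections hG.
  move: s0; set Sg := (\sum_j _); move: Sg => Sg; move: lh; clear; lia.
have [n nE] : exists n : nat, m%:Z - \sum_j A i j * d j = n%:Z by apply: nonneg_natr; lia.
exists n; last by lia.
by rewrite (pairing_shift (reflections greedy)) pm -/(d _) -[m%:R]/(m%:Z%:~R) -rmorphD /= nE.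
Qed.

(** Take [T] maximal such that [filled T] is reached; the vertex of largest
    key missing from [T] could be added. *)
Lemma greedy_fill X : descent_closed greedy X -> X (filled S).
Proof.
move=> cX; have [X0 _ F2] := cX.
pose Q (T : {set I}) := (T \subset S) && `[< X (filled T) >].
have Q0 : Q finset.set0.
  rewrite /Q finset.sub0set; apply/asboolP.
  by have -> : filled finset.set0 = reflections greedy by apply/funext => j; rewrite /filled inE.
have [T /maxsetP[/andP[TS /asboolP XT] maxT]] := ex_maxset (ex_intro Q _ Q0).
have stop i n : i \in S -> i \notin T -> (reflections greedy i + n = k i)%N ->
    ~ X (step (filled T) i n).
  move=> iS iT kn; rewrite fill_step // => Xi.
  have QiT : Q (i |: T) by rewrite /Q finset.subUset finset.sub1set iS TS; apply/asboolP.
  by have /setP/(_ i) := maxT _ QiT (finset.subsetUr _ _); rewrite !inE eqxx (negPf iT).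
have GT : greedy \subset T.
  apply/fintype.subsetP => h hG; apply/negPn/negP => hT.
  have [hS _ _ _] := greedyP hG.
  have kh := filled_ge S h; rewrite /filled hS in kh.
  apply: (stop h (k h - reflections greedy h)%N) => //; first by rewrite subnKC.
  by apply: closed_step_free => // m; exact: reflections_free.
have [TeS|] := eqVneq T S; first by rewrite -TeS.
move=> TnS; exfalso.
have [i0 i0D] : exists i0, i0 \in S :\: T.
  by apply/set0Pn; rewrite finset.setD_eq0; apply: contra TnS => ST; rewrite finset.eqEsubset TS.
have [i iD imax] := @arg_maxnP _ i0 (fun i => i \in S :\: T) key i0D.
move: iD; rewrite inE => /andP[iT iS].
have iG : i \notin greedy by apply: contra iT => /(fintype.subsetP GT).
have ri : (reflections greedy i + k i = k i)%N by rewrite /reflections (negPf iG).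
apply: (stop _ _ iS iT ri).
have [fi|] := pselect (forall m, pairing (reflections greedy) i <> m%:R).
  exact: closed_step_free.
move=> /existsNP[m /contrapT pm].
have prev j : j \in S -> (key i < key j)%N -> j \in T.
  move=> jS ij; apply/negPn/negP => jT; have := imax j; rewrite inE jS jT => /(_ isT).
  by move=> ji; move: ij; rewrite ltnNge => /negP; apply; exact: ji.
have [n pn kn] := greedy_pairing GT iS iT prev pm.
exact: F2 pn kn XT.
Qed.

(** Below [k] and above [filled S], a descent that stops at [m] has
    nonpositive pairings at all the vertices R where m < k. With u = m and c =
    k - m, dominance of k makes A c <= 0 on R, while the pairings make A u >=
    0. The set given by [min_ratio] is then a union of components of the
    support of k on which all labels vanish; excluding such sets is the last
    assumption. *)
Lemma descent_reaches X :
  (forall i, i \notin S -> P i /\ \sum_j A i j * (k j)%:Z <= (l i)%:Z) ->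
  (forall C : {set I}, C != finset.set0 -> {in C, forall i,
     [/\ i \notin S, (0 < k i)%N, l i = 0%N &
       forall j, (0 < k j)%N -> A i j != 0 -> j \in C]} -> False) ->
  descent_closed greedy X -> X k.
Proof.
move=> dom nondeg cX; have [_ _ F2] := cX.
have offS i : i \notin S -> filled S i = 0%N.
  move=> iS; rewrite /filled /reflections (negPf iS) ifN //.
  by apply: contra iS => /greedyP[].
have : exists m, [/\ X m, {in S, m =1 k} & forall i, (m i <= k i)%N].
  exists (filled S); split; first exact: greedy_fill.
    by move=> i iS; rewrite /filled iS.
  by move=> i; have [iS|/offS -> //] := boolP (i \in S); rewrite /filled iS.
case=> m; have [n] := ubnP (\sum_i (k i - m i))%N.
elim: n m => // n IH m mn [Xm mS mk].
pose R := [set i | (m i < k i)%N].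
have RS i : i \in R -> i \notin S by rewrite inE => mi; apply/negP => /mS mE; rewrite mE ltnn in mi.
have [R0|Rn] := eqVneq R finset.set0.
  suff -> : k = m by []. 
  apply/funext => i; apply/eqP; rewrite eqn_leq mk leqNgt andbT.
  by have /setP/(_ i) := R0; rewrite !inE => ->.
have [[i iR pos]|npos] := pselect (exists2 i, i \in R & 0 < (l i)%:Z - \sum_j A i j * (m j)%:Z).
  have [Pi _] := dom _ (RS _ iR); have mi : (m i < k i)%N by rewrite inE in iR.
  have [q qE] : exists q : nat, (l i)%:Z - \sum_j A i j * (m j)%:Z = q%:Z.
    by apply: nonneg_natr; lia.
  apply: (IH (step m i 1)).
    move: mn; rewrite (bigD1 i) //= [X in _ -> (X < _)%N](bigD1 i) //= {1}/step eqxx.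
    rewrite [X in _ -> (_ + X < _)%N](eq_bigr (fun j => k j - m j)%N); first by lia.
    by move=> j /negPf ji; rewrite /step ji muln0 addn0.
  split.
  - apply: (F2 i m q 1%N) => //; last by lia.
    by rewrite /pairing lamP // -[(l i)%:R]/((l i)%:Z%:~R) -rmorphB /= qE.
  - move=> j jS; rewrite /step mS //; case: eqP => [ji|]; last by rewrite addn0.
    by have := RS _ iR; rewrite -ji jS.
  - by move=> j; rewrite /step; case: eqP => [->|_]; [lia | rewrite addn0].
exfalso; pose u i := (m i)%:Z; pose c i := (k i)%:Z - (m i)%:Z.
have low i : i \in R -> (l i)%:Z <= \sum_j A i j * u j.
  by move=> iR; have /forall2NP/(_ i)[//|/negP] := npos; rewrite -leNgt /u; lia.
have splitR i (f : I -> int) :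
    \sum_j A i j * f j = \sum_(j in R) A i j * f j + \sum_(j | j \notin R) A i j * f j.
  by rewrite (bigID (fun j => j \in R)).
have offR i : i \in R -> \sum_(j | j \notin R) - (A i j * u j) >= 0.
  move=> iR; apply: sumr_ge0 => j jR; rewrite oppr_ge0 mulr_le0_ge0 //.
  by apply: (cartan_le0 hA); apply: contraNneq jR => <-.
have [|||C [C0 CR HC]] := @min_ratio _ _ hA R u c Rn.
- by move=> i; rewrite inE /c /u => mi; split; lia.
- move=> i iR; have [_ kl] := dom _ (RS _ iR); have := low _ iR.
  have -> : \sum_(j in R) A i j * c j = \sum_j A i j * c j.
    rewrite splitR [X in _ = _ + X]big1 ?addr0 // => j; rewrite inE -leqNgt => kj.
    by have := mk j; rewrite /c => mj; suff -> : (k j)%:Z - (m j)%:Z = 0; [rewrite mulr0 | lia].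
  have -> : \sum_j A i j * c j = \sum_j A i j * (k j)%:Z - \sum_j A i j * u j.
    by rewrite -sumrB; apply: eq_bigr => j _; rewrite /c /u mulrBr.
  by move: kl; set x := \sum_j _; set y := \sum_j _; lia.
- move=> i iR; have := low _ iR; have := offR _ iR; rewrite splitR sumrN.
  by set x := \sum_(j in R) _; set y := \sum_(j | _) _; lia.
apply: (nondeg C C0) => i iC; have iR := fintype.subsetP CR _ iC.
have [Ri nb] := HC _ iC; have := low _ iR; have := offR _ iR.
rewrite splitR Ri add0r sumrN => offi lowi.
have l0 : l i = 0%N by move: offi lowi; set y := \sum_(j | _) _; lia.
split=> //; [exact: RS | by move: iR; rewrite inE => /(leq_ltn_trans (leq0n _)) |].
move=> j kj Aij; have [jR|jR] := boolP (j \in R); first exact: nb.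
have : \sum_(j | j \notin R) - (A i j * u j) == 0.
  by rewrite sumrN; move: offi lowi; set y := \sum_(j | _) _; lia.
rewrite psumr_eq0; last first.
  move=> t tR; rewrite oppr_ge0 mulr_le0_ge0 //.
  by apply: (cartan_le0 hA); apply: contraNneq tR => <-.
move/allP/(_ j (mem_index_enum j)); rewrite jR /= oppr_eq0 mulf_eq0 (negPf Aij) /=.
by move: jR kj; rewrite inE /u; have := mk j; lia.
Qed.

End Descent.

(** * Hole vectors determine the weights *)

Section WordCombinatorics.
Context (I : finType) (A : I -> I -> int).

Definition block (s : seq I) (n : I -> nat) : seq I := flatten [seq nseq (n i) i | i <- s].

Lemma mem_block s n i : i \in block s n -> i \in s.
Proof. by move/flattenP => [_ /mapP[j js ->]] /nseqP[-> _]. Qed.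

Lemma content_block s n i : uniq s -> content (block s n) i = if i \in s then n i else 0%N.
Proof.
rewrite /content /block; elim: s => //= j s IH /andP[js us].
rewrite count_cat count_nseq IH //= inE eq_sym.
by have [->|] /= := eqVneq i j; rewrite ?(negPf js) ?mul1n ?addn0.
Qed.

Lemma eq_block s n n' : {in s, n =1 n'} -> block s n = block s n'.
Proof. by move=> nn; rewrite /block; congr flatten; apply/eq_in_map => i /nn ->. Qed.

Definition hole_word (l : I -> nat) (S : {set I}) : seq I := block (enum S) (fun i => (l i).+1).

Lemma content_hole_word l S : content (hole_word l S) = reflections l S.
Proof. by apply/funext => i; rewrite content_block ?enum_uniq // mem_enum. Qed.

Lemma commuting_block s n : {in s &, forall i j, i != j -> A i j = 0} -> commuting A (block s n).
Proof.
move=> As i j /mem_block iS /mem_block jS; have [->|ij] := eqVneq i j; first by right.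
by left; exact: As.
Qed.

Lemma commuting_hole_word l S : independent A S -> commuting A (hole_word l S).
Proof. by move=> iS; apply: commuting_block => i j; rewrite !mem_enum; exact: iS. Qed.

(** The letters of [w] that commute with everything to their right: after
    moving them, [w] ends with their product. *)
Fixpoint ends (w : seq I) : seq I :=
  if w is i :: w' then
    if all (fun j => (i != j) && (A i j == 0)) w' then i :: ends w' else ends w'
  else [::].

Lemma ends_sub w : {subset ends w <= w}.
Proof.
elim: w => //= i w IH j; case: ifP => _; rewrite !inE.
  by case/orP => [->//|/IH ->]; rewrite orbT.
by move/IH => ->; rewrite orbT.
Qed.

Lemma ends_commuting w : generalized_cartan A -> commuting A (ends w).
Proof.
move=> hA; elim: w => //= i w IH; case: ifP => // /allP iw a b.
have [_ _ As] := hA; rewrite !inE => /orP[/eqP->|aw] /orP[/eqP->|bw].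
- by right.
- by left; have /andP[_ /eqP] := iw b (ends_sub bw).
- by left; apply: As; have /andP[_ /eqP] := iw a (ends_sub aw).
- exact: IH.
Qed.

(** The rightmost letter of [w] in [C] has no neighbour, and no copy of
    itself, to its right, for such a letter would be in [C]. *)
Lemma ends_closed (C : {set I}) w : has (mem C) w ->
  (forall i j, i \in C -> j \in w -> A i j != 0 -> j \in C) ->
  exists2 i, i \in C & i \in ends w.
Proof.
elim: w => //= i w IH iwC cC; have [wC|wC] := boolP (has (mem C) w).
  have [|j jC jw] := IH wC.
    by move=> a b aC bw; apply: cC => //; rewrite inE bw orbT.
  by exists j => //; case: ifP => // _; rewrite inE jw orbT.
have iC : i \in C by move: iwC; rewrite (negPf wC) orbF.
exists i => //; rewrite ifT ?inE ?eqxx //; apply/allP => j jw.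
have jC : j \notin C by apply: contra wC => jC; apply/hasP; exists j.
apply/andP; split; first by apply: contraNneq jC => <-.
by apply/negPn/negP => Aij; case/negP: jC; apply: cC Aij => //; rewrite inE jw orbT.
Qed.

End WordCombinatorics.

Section Comparison.
Context (K : fieldType) (char0 : forall n : nat, n.+1%:R != 0 :> K).
Context (I : finType) (A : I -> I -> int) (rz : realization K A).
Context (hA : generalized_cartan A) (g : kac_moody rz).
Local Notation h := (cartan rz).
Local Notation alpha := (Defs.root rz).
Local Notation E := (km_e g).
Local Notation F := (km_f g).

Lemma lowered_step (lam : dual h) k i n :
  lowered lam (step k i n) = lowered lam k - alpha i *+ n.
Proof. exact: lowered_incr. Qed.

Section Chains.
Context (V : lieModType g).
Implicit Types (u v x : V) (B N : set V) (s w : seq I).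

(** Moving the letters of [s] to the right end exhibits [fword w v] as a word
    applied to [fword s v]. *)
Lemma ends_factor w s N v : uniq s -> {subset s <= ends A w} -> submod N ->
  N (fword s v) -> N (fword w v).
Proof.
elim: w s v => [|i w IH] s v us sw sN Ns.
  by case: s sw us Ns => // a s /(_ a); rewrite inE eqxx => /(_ isT).
have cs : commuting A s by move=> a b /sw aw /sw bw; exact: (ends_commuting hA aw bw).
case iw : (all (fun j => (i != j) && (A i j == 0)) w); last first.
  by apply: sN.2; apply: IH us _ sN Ns => a /sw; rewrite /= iw.
have sub_rem : {subset rem i s <= ends A w}.
  move=> a; rewrite mem_rem_uniq // !inE => /andP[ai /sw].
  by rewrite /= iw inE (negPf ai).
have [is_|is_] := boolP (i \in s); last first.
  apply: sN.2; apply: IH us _ sN Ns => a asn; apply: sub_rem.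
  by rewrite rem_id.
rewrite /= lact_F_fword; last first.
  by move=> j jw; left; have /andP[_ /eqP] := allP iw j jw.
apply: (IH (rem i s)) => //; first exact: rem_uniq.
have sperm : perm_eq s (rem i s ++ [:: i]).
  by apply: (perm_trans (perm_to_rem is_)); rewrite perm_sym cats1 perm_rcons.
by have := fword_perm v cs sperm; rewrite fword_cat /= => <-.
Qed.

(** The vectors killed, modulo [B], by some product of powers of the lowering
    operators in [s]. Taking the operators one at a time makes this a
    submodule, by iteration of [nil_mod_submod]. *)
Fixpoint nil_chain s B : set V :=
  if s is i :: s' then nil_chain s' (nil_mod (F i) B) else B.

Lemma nil_chain_submod s B : submod B -> submod (nil_chain s B).
Proof.
elim: s B => //= i s IH B sB; apply: IH; apply: nil_mod_submod sB; exact: ad_nil_F.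
Qed.

Lemma nil_chain_block s B n u : B (fword (block s n) u) -> nil_chain s B u.
Proof.
elim: s B u => //= i s IH B u; rewrite /block /= fword_cat fword_nseq => Bu.
by apply: IH; exists (n i).
Qed.

Lemma nil_chainP s B u : uniq s -> nil_chain s B u -> exists n, B (fword (block s n) u).
Proof.
elim: s B u => [|i s IH] B u /=; first by exists (fun=> 0%N).
case/andP=> is_ us /(IH _ _ us)[n [m Bm]].
exists (fun j => if j == i then m else n j); rewrite /block /= fword_cat fword_nseq eqxx.
rewrite -/(block s _) (@eq_block _ _ _ n) // => j js.
by case: eqP => // ji; rewrite -ji js in is_.
Qed.

Lemma fword_E i w u : i \notin w -> lact (E i) (fword w u) = fword w (lact (E i) u).
Proof.
elim: w => //= j w IH; rewrite inE negb_or => /andP[ij iw].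
by rewrite lact_comm lie_EF (negPf ij) lact0l add0r IH.
Qed.

Lemma fword_iter_E i n w u : i \notin w ->
  iter n (lact (E i)) (fword w u) = fword w (iter n (lact (E i)) u).
Proof. by move=> iw; elim: n => //= n ->; exact: fword_E. Qed.

Lemma independent_coroot mu w i : (forall j, j \in w -> A i j = 0) ->
  lowered mu (content w) (coroot rz i) = mu (coroot rz i) :> K.
Proof.
move=> iw; rewrite lowered_coroot big1 ?subr0 // => j _.
have [jw|jw] := boolP (j \in w); first by rewrite iw // mul0r.
by rewrite /content (count_memPn jw) mulr0.
Qed.

(** At a vertex i of [s] the word without i has the same negative weight -p at
    i as x, and is still killed by E_i ^ p, since E_i commutes with the other
    letters. If a power of F_i killed it, it would vanish by [string_up]. *)
Lemma block_injective mu s n x : uniq s -> {in s &, forall i j, i != j -> A i j = 0} ->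
  weight_space mu x ->
  (forall i, i \in s -> exists2 p, mu (coroot rz i) = - p%:R :> K & iter p (lact (E i)) x = 0) ->
  fword (block s n) x = 0 -> x = 0.
Proof.
elim: s => // i s IH /= /andP[is_ us] As wx Ex; rewrite /block /= fword_cat fword_nseq -/(block s n).
have ib : i \notin block s n by apply: contra is_ => /mem_block.
have [p mup Ep] := Ex i (mem_head _ _).
move=> Fx; apply: IH => //.
- by move=> a b aS bS; apply: As; rewrite inE ?aS ?bS orbT.
- by move=> j js; apply: Ex; rewrite inE js orbT.
apply: (string_up char0 hA (fword_weight (block s n) wx) _ Fx (p := p)).
  rewrite -mup; apply: independent_coroot => j /mem_block js.
  by apply: As; rewrite ?inE ?eqxx ?js ?orbT //; apply: contraNneq is_ => ->.
by rewrite fword_iter_E // Ep fword0.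
Qed.

End Chains.

Context (lam : dual h).

Definition integral i : bool := `[< exists n : nat, lam (coroot rz i) = n%:R :> K >].
Definition label i : nat := xget 0%N [set n : nat | lam (coroot rz i) = n%:R :> K]%classic.

Lemma labelP i : integral i -> lam (coroot rz i) = (label i)%:R :> K.
Proof. by move/asboolP => ex; exact: (xgetPex 0%N ex). Qed.

Lemma integralN i n : ~~ integral i -> (lam (coroot rz i) : K) <> n%:R.
Proof. by move/asboolP => H ln; apply: H; exists n. Qed.

(** The sets of commuting simple reflections whose product for the dot action
    lowers lam to the weight of a singular vector. *)
Definition candidate (S : {set I}) : Prop :=
  independent A S /\ {in S, forall i, integral i}.

Definition hole_vector (V : lieModType g) (S : {set I}) (v : V) : V :=
  fword (hole_word label S) v.

Section OneModule.
Context (V : lieModType g) (v : V) (hv : highest_weight lam v).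

Lemma hole_vector_weight S : weight_space (lowered lam (reflections label S)) (hole_vector S v).
Proof. by rewrite -content_hole_word; apply: fword_weight; case: hv. Qed.

(** For i in [S], the other letters produce a vector killed by E_i and of
    weight l_i at i, which F_i ^ (l_i + 1) sends to a vector killed by E_i
    again. For i outside [S], E_i commutes with all letters. *)
Lemma hole_vector_singular S i : candidate S -> lact (E i) (hole_vector S v) = 0.
Proof.
move=> [iS PS]; have [wv Ev _] := hv.
have [iin|iin] := boolP (i \in S); last first.
  rewrite /hole_vector fword_E ?Ev ?fword0 //.
  by apply: contra iin => /mem_block; rewrite mem_enum.
pose w := hole_word label (S :\ i).
have iw : i \notin w by apply/negP => /mem_block; rewrite mem_enum !inE eqxx.
have -> : hole_vector S v = iter (label i).+1 (lact (F i)) (fword w v).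
  rewrite -fword_nseq -fword_cat; apply: (fword_perm v (commuting_hole_word (l := label) iS)).
  apply: perm_content; rewrite content_hole_word; apply/funext => j.
  rewrite /content count_cat -/(content w j) content_hole_word count_nseq /reflections !inE /=.
  by rewrite eq_sym; have [->|] := eqVneq j i; rewrite ?iin /= ?mul1n ?addn0.
apply: (singular_next hA (fword_weight w wv)).
  by rewrite fword_E // Ev fword0.
rewrite -(labelP (PS i iin)); apply: independent_coroot => j /mem_block.
by rewrite mem_enum !inE => /andP[ji jS]; apply: iS => //; rewrite eq_sym.
Qed.

(** The hole vector spans its weight space, so a homogeneous submodule
    contains it as soon as one element has a component of that weight. *)
Lemma hole_split (S : {set I}) N u : candidate S -> submod N -> N u ->
  ~ off_weight (lowered lam (reflections label S)) u -> N (hole_vector S v).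
Proof.
move=> [iS _] sN Nu nou; rewrite -content_hole_word in nou.
have [c [y [oy uE]]] := commuting_weight char0 hv u (commuting_hole_word (l := label) iS).
have [c0|c0] := eqVneq c 0; first by case: nou; rewrite uE c0 scale0r add0r.
have wh : weight_space (lowered lam (content (hole_word label S))) (c *: fword (hole_word label S) v).
  have [wv _ _] := hv.
  by move=> x; rewrite lactZr (fword_weight (hole_word label S) wv) !scalerA mulrC.
have := submod_component sN wh oy; rewrite -uE => /(_ Nu).
move=> /(subspace_scale c^-1 sN.1); by rewrite scalerK.
Qed.

(** The quotient by the largest submodule that avoids the weight of the hole
    vector of G replaces the simple module with that highest weight: each
    nonzero submodule of it contains the hole vector. If F_i kills a nonzero
    vector there, the submodule where F_i is locally nilpotent therefore
    contains the singular hole vector, whose weight at i must then be a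
    natural number. So the weights of the quotient satisfy [descent_closed]. *)
Lemma subset_weight (S : {set I}) k :
  (forall T : {set I}, T \subset S -> candidate T -> hole_vector T v != 0) ->
  (forall i, i \notin S -> integral i /\ \sum_j A i j * (k j)%:Z <= (label i)%:Z) ->
  (forall C : {set I}, C != finset.set0 -> {in C, forall i,
     [/\ i \notin S, (0 < k i)%N, label i = 0%N &
       forall j, (0 < k j)%N -> A i j != 0 -> j \in C]} -> False) ->
  wt V (lowered lam k).
Proof.
move=> nh dom nondeg; pose G := greedy A integral label k S.
have candG : candidate G.
  by split; [exact: greedy_independent | move=> i /greedyP[]].
have GS : G \subset S by apply/fintype.subsetP => i /greedyP[].
pose mu := lowered lam (reflections label G).
pose y := hole_vector G v; have y0 : y != 0 by exact: nh.
pose Q := core (off_weight mu : set V); have sQ : submod Q by apply: core_submod; exact: off_weight_subspace.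
pose p := @qproj K g V Q.
have pm : lmod_morphism p by exact: qproj_morph.
have ps : forall z, exists u, p u = z by exact: qproj_surj.
have wy : weight_space mu y by exact: hole_vector_weight.
have py0 : p y != 0.
  apply/eqP => /(qproj_eq0 _ sQ) /core_sub oy.
  by case/eqP: y0; exact: off_weight_disjoint wy oy.
have cosocle N z : submod N -> N z -> z != 0 -> N (p y).
  have [u <-] := ps z => sN Nu pu0.
  have sN' := preim_submod pm sN.
  apply: contrapT => Ny; case/eqP: pu0; apply/(qproj_eq0 _ sQ).
  apply: (core_max sN') Nu => t Nt; apply: contrapT => ot; apply: Ny.
  exact: (hole_split candG sN' Nt ot).
have hw := highest_weight_morph pm ps hv.
apply: (wt_morph pm ps hv); pose X k' := wt (quot Q) (lowered lam k').
apply: (@descent_reaches K char0 I A hA (fun i => lam (coroot rz i)) integral label _ _ k S X) => //.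
- exact: labelP.
- by move=> i n; exact: integralN.
split.
- by exists (p y) => //; exact: weight_morph.
- move=> i k' free [z wz z0]; exists (lact (F i) z).
    by rewrite lowered_step; exact: weight_F.
  apply/eqP => Fz.
  have [n Fn] : nil_mod (F i) [set 0]%classic (p y).
    apply: cosocle z0; last by exists 1%N.
    by apply: nil_mod_submod (ad_nil_F g i) _; exact: submod0.
  have Ey : lact (E i) (p y) = 0 by rewrite -pm hole_vector_singular // linear0.
  have [m] := singular_string_F char0 hA (weight_morph pm wy) Ey py0 Fn.
  by rewrite lowered_coroot => lm; exact: (free m).
- move=> i k' m n pk nm [z wz z0]; exists (iter n (lact (F i)) z).
    by rewrite lowered_step; exact: weight_iter_F.
  apply: (string_down char0 hA wz _ nm) z0; first by rewrite lowered_coroot.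
  exact: (E_nil hw).
Qed.

End OneModule.

Lemma size_content (w w' : seq I) i p : content w = step (content w') i p ->
  size w = (size w' + p)%N.
Proof.
move=> cw; have /perm_size -> : perm_eq w (w' ++ nseq p i).
  apply: perm_content; rewrite cw; apply/funext => j.
  by rewrite /content count_cat count_nseq /step /= mulnC eq_sym.
by rewrite size_cat size_nseq.
Qed.

(** If no raising to a reflected weight is possible from x = f_w v, the hole
    vectors of all T inside the set S below are nonzero. Write T as the union
    of G, where mu is negative, and of L, made of movable letters of label 0.
    If F_T v = F_G F_L v were zero, F_L v would lie in a submodule on which
    powers of the operators in G are jointly nilpotent; so would x, a word
    applied to F_L v; but mu is negative on G, and [block_injective] forbids
    this. The letters of label 0 are included in S to satisfy the last
    assumption of [subset_weight]: a component of the support of w on which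
    lam vanishes contains a movable letter. *)
Lemma wt_determined (V V' : lieModType g) (v : V) (v' : V') :
  highest_weight lam v -> highest_weight lam v' ->
  (forall S, candidate S -> hole_vector S v != 0 -> hole_vector S v' != 0) ->
  (wt V `<=` wt V')%classic.
Proof.
move=> hv hv' holes; have [wv Ev _] := hv.
suff main n w : (size w < n)%N -> fword w v != 0 -> wt V' (lowered lam (content w)).
  move=> mu [u wu u0]; have [w -> w0] := weight_word hv wu u0.
  exact: main (ltnSn _) w0.
elim: n w => // n IH w wn x0; set x := fword w v; set k := content w.
have wx : weight_space (lowered lam k) x by exact: fword_weight.
have [[i [p [p0 mup Ex]]]|nup] := pselect (exists i p,
    [/\ (0 < p)%N, lowered lam k (coroot rz i) = - p%:R :> K & iter p (lact (E i)) x != 0]).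
  (* The reflected weight is that of a shorter word. *)
  have [w' wE w'0] := weight_word hv (weight_iter_E i p wx) Ex.
  have kE : k = step (content w') i p.
    apply: (lowered_inj char0 (lam := lam)).
    by rewrite lowered_step -wE addrK.
  have [|z wz z0] := IH w' _ w'0; first by have := size_content kE; lia.
  exists (iter p (lact (F i)) z).
    by rewrite kE lowered_step; exact: weight_iter_F.
  apply: (string_down char0 hA wz _ (leqnn p)) z0; last exact: (E_nil hv').
  rewrite -wE add_lfunE mup -scaler_nat scale_lfunE alpha_coroot //.
  by rewrite /GRing.scale /=; ring.
(* The vertices where mu is dominant integral. *)
pose D i := integral i && (\sum_j A i j * (k j)%:Z <= (label i)%:Z).
pose S := [set i | ~~ D i || ((i \in ends A w) && (label i == 0%N))].
apply: (subset_weight hv' (S := S)).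
- move=> T TS [iT PT]; apply: holes => //; apply/eqP => T0.
  pose G := T :&: [set i | ~~ D i]; pose L := T :&: [set i | D i].
  have Lend i : i \in L -> i \in ends A w /\ label i = 0%N.
    rewrite !inE => /andP[/(fintype.subsetP TS)]; rewrite inE => /orP[/negPf ->//|/andP[-> /eqP ->]] //.
  have iG : {in enum G &, forall i j, i != j -> A i j = 0}.
    by move=> i j; rewrite !mem_enum !inE => /andP[iT' _] /andP[jT _]; exact: iT.
  pose N := nil_chain (enum G) ([set 0]%classic : set V).
  have sN : submod N by apply: nil_chain_submod; exact: submod0.
  have NL : N (fword (enum L) v).
    apply: (nil_chain_block (n := fun i => (label i).+1)).
    rewrite -fword_cat -T0; apply/esym/fword_perm; first exact: commuting_hole_word.
    apply: perm_content; rewrite content_hole_word; apply/funext => i.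
    rewrite /content count_cat -/(content _ i) content_block ?enum_uniq // /reflections.
    rewrite count_uniq_mem ?enum_uniq // !mem_enum.
    have := Lend i; rewrite !inE; case: (i \in T) => //=.
    by case: (D i) => [/(_ isT)[_ ->]|_] /=; rewrite ?addn0.
  have Nx : N x.
    apply: ends_factor (enum_uniq L) _ sN NL => i; rewrite mem_enum => iL.
    by case: (Lend i iL).
  have [m Fm] := nil_chainP (enum_uniq G) Nx.
  case/eqP: x0; apply: (block_injective (enum_uniq G) iG wx _ Fm) => i.
  rewrite mem_enum !inE negb_and => /andP[iT' Di].
  have Pi := PT i iT'; rewrite Pi /= -ltNge in Di.
  have [p pE] : exists p : nat, \sum_j A i j * (k j)%:Z - (label i)%:Z = p%:Z.
    by apply: nonneg_natr; rewrite subr_ge0 ltW.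
  have mup : lowered lam k (coroot rz i) = - p%:R :> K.
    rewrite lowered_coroot labelP // -[p%:R]/(p%:Z%:~R) -pE rmorphB opprB //.
  exists p => //; apply: contrapT => /eqP Ep; apply: nup; exists i, p; split=> //.
  by rewrite -ltz_nat -pE subr_gt0.
- by move=> i; rewrite inE negb_or negbK => /andP[/andP[]].
- move=> C /set0Pn[i iC] HC.
  have kw j : (0 < k j)%N = (j \in w) by rewrite /k /content -has_count has_pred1.
  have [||j jC jend] := @ends_closed I A C w.
  + by apply/hasP; exists i => //; rewrite -kw; have [] := HC i iC.
  + by move=> a b aC; rewrite -kw => kb Aab; have [_ _ _ ->] := HC a aC.
  have [jS _ l0 _] := HC j jC; case/negP: jS.
  by rewrite inE jend l0 eqxx orbT.
Qed.

End Comparison.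

(** * The interval of highest weight modules with a given weight set *)

Section Interval.
Context (K : fieldType) (char0 : forall n : nat, n.+1%:R != 0 :> K).
Context (I : finType) (A : I -> I -> int) (rz : realization K A).
Context (hA : generalized_cartan A) (g : kac_moody rz) (lam : dual (cartan rz)).
Local Notation M := (verma g lam).
Local Notation vM := (verma_hw g lam).

(** The weight space of the highest weight is a line, and it generates the
    module. *)
Lemma endo_scalar (V : lieModType g) (v : V) (f : {linear V -> V}) :
  highest_weight lam v -> lmod_morphism f -> exists c, forall u, f u = c *: u.
Proof.
move=> hv fm; have [wv _ genv] := hv.
have [c [y [oy fv]]] := commuting_weight char0 hv (f v) (w := [::]) (fun i j => fun H => False_ind _ (notF H)).
exists c; suff fcv : f v = c *: v.
  apply: genv fcv; split; first split.
  - by rewrite linear0 scaler0.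
  - by move=> a x z fx fz; rewrite linearP fx fz scalerDr !scalerA mulrC.
  - by move=> x u fu; rewrite fm fu lactZr.
have lam0 : lowered lam (content [::]) = lam by exact: lowered0.
rewrite fv /=; suff -> : y = 0 by rewrite addr0.
apply: off_weight_disjoint oy; rewrite lam0 => x.
have -> : y = f v - c *: v by rewrite fv /= addrC addKr.
by rewrite linearB /= lactZr (weight_morph fm wv) wv scalerBr !scalerA mulrC.
Qed.

Lemma surjects_antisym (V W : lieModType g) (v : V) :
  highest_weight lam v -> surjects V W -> surjects W V -> lmod_iso V W.
Proof.
move=> hv [f [fm fs]] [f' [fm' fs']]; exists f; split=> //.
have [|c fc] := @endo_scalar V v (f' \o f)%FUN hv.
  by move=> x u /=; rewrite fm fm'.
have finj : injective f.
  move=> u u' fu; have [c0|c0] := eqVneq c 0.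
    have V0 (z : V) : z = 0.
      have [w <-] := fs' z; have [t <-] := fs w.
      by have := fc t; rewrite c0 scale0r.
    by rewrite (V0 u) (V0 u').
  have /(scalerI c0) // : c *: u = c *: u' by rewrite -!fc /= fu.
pose f1 w := sval (cid (fs w)).
have f1K : cancel f1 f by move=> w; rewrite /f1; case: cid.
by exists f1 => // u; apply: finj; rewrite f1K.
Qed.

Lemma surjects_hw (V : lieModType g) : surjects M V -> exists v : V, highest_weight lam v.
Proof.
move=> [f [fm fs]]; exists (f vM).
refine (highest_weight_morph fm fs (verma_highest_weight g lam)).
Qed.

Lemma surjects_wt (V W : lieModType g) :
  surjects M V -> surjects V W -> (wt W `<=` wt V)%classic.
Proof. by move=> /surjects_hw[v hv] [f [fm fs]]; exact: wt_morph fm fs _ hv. Qed.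

Context (V : lieModType g) (f : {linear M -> V}).
Hypotheses (fm : lmod_morphism f) (fs : forall v, exists u, f u = v).

Let hM : highest_weight lam vM := verma_highest_weight g lam.
Let hv : highest_weight lam (f vM) := highest_weight_morph fm fs hM.
Let hV : surjects M V := ex_intro _ f (conj fm fs).

Definition off_weight_vectors : set M :=
  [set u | exists mu, ~ wt V mu /\ weight_space mu u]%classic.

(** The vectors with no component along the hole vectors that survive in [V]. *)
Definition avoids_holes : set M :=
  [set u | forall T, candidate lam T -> hole_vector lam T (f vM) != 0 ->
     off_weight (lowered lam (reflections (label lam) T)) u]%classic.

Definition max_module := quot (gen off_weight_vectors).
Definition min_module := quot (core avoids_holes).
HB.instance Definition _ := LieModule.on max_module.
HB.instance Definition _ := LieModule.on min_module.

Lemma avoids_holes_subspace : subspace avoids_holes.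
Proof.
have sO T := @off_weight_subspace _ _ _ _ g M (lowered lam (reflections (label lam) T)).
split=> [T _ _|a u u' au au' T cT T0]; first by case: (sO T).
by have [_ H] := sO T; apply: H; [exact: au | exact: au'].
Qed.

Lemma max_module_surjects (W : lieModType g) :
  surjects M W -> wt W = wt V -> surjects max_module W.
Proof.
move=> [p [pm ps]] wW; have sN := gen_submod off_weight_vectors.
apply: (surjects_factor (@qproj_morph _ _ M _) pm (@qproj_surj _ _ M _) ps) => u.
move=> /(qproj_eq0 _ sN)/(_ [set x | p x = 0]%classic); apply; first exact: ker_submod.
move=> x [mu [nmu wx]]; apply: contrapT => px; apply: nmu; rewrite -wW.
by exists (p x); [exact: weight_morph | exact/eqP].
Qed.

(** The kernel of the map onto [W] avoids each hole vector that survives in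
    [V]: its weight is a weight of [V], hence of [W], so that the hole vector,
    which spans its weight space, is nonzero in [W]. *)
Lemma surjects_min_module (W : lieModType g) :
  surjects M W -> wt W = wt V -> surjects W min_module.
Proof.
move=> [p [pm ps]] wW.
have sN := core_submod avoids_holes_subspace.
apply: (surjects_factor pm (@qproj_morph _ _ M _) ps (@qproj_surj _ _ M _)) => u pu.
apply/(qproj_eq0 _ sN); apply: (core_max (ker_submod pm)) pu => t pt T cT T0.
apply: contrapT => ot.
have /= := hole_split char0 hM cT (ker_submod pm) pt ot.
rewrite /hole_vector fword_morph // => pT0.
have : wt W (lowered lam (reflections (label lam) T)).
  by rewrite wW; exists (hole_vector lam T (f vM)) => //; exact: hole_vector_weight.
move=> [y wy y0]; have hW := highest_weight_morph pm ps hM.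
have [w wE] := weight_word hW wy y0; case/eqP.
rewrite -[RHS]pT0; apply/esym; apply: fword_perm.
  by apply: commuting_hole_word; case: cT.
apply: perm_content; rewrite content_hole_word.
exact: (lowered_inj char0 wE).
Qed.

Lemma wt_max_module : wt max_module = wt V.
Proof.
apply/seteqP; split=> mu.
  move=> [y wy y0].
  have [x wx xy] := weight_lift (@qproj_morph _ _ M _) (@qproj_surj _ _ M _)
    (verma_highest_weight g lam) wy.
  apply: contrapT => nmu; case/eqP: y0; rewrite -xy; apply/qproj_eq0; first exact: gen_submod.
  by apply: sub_gen; exists mu.
by apply: surjects_wt; [exact: quot_surjects | exact: max_module_surjects].
Qed.

Lemma wt_min_module : wt min_module = wt V.
Proof.
apply/seteqP; split.
  by apply: surjects_wt; [exact: hV | exact: surjects_min_module].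
have sN := core_submod avoids_holes_subspace.
apply: (wt_determined char0 hA hv (highest_weight_morph (@qproj_morph _ _ M _) (@qproj_surj _ _ M _) hM)).
move=> T cT T0; apply/eqP; rewrite /hole_vector -fword_morph; last exact: qproj_morph.
move=> /(qproj_eq0 _ sN)/core_sub/(_ T cT T0) oT.
have vT0 := off_weight_disjoint (hole_vector_weight hM T) oT.
by case/eqP: T0; rewrite /hole_vector -fword_morph // -/(hole_vector lam T vM) vT0 linear0.
Qed.

Lemma min_max_bounds : weight_set_bounds lam (wt V) max_module min_module.
Proof.
move=> W hW; split=> [wW|[maxW Wmin]].
  by split; [exact: max_module_surjects | exact: surjects_min_module].
apply/seteqP; split; first by rewrite -wt_max_module; apply: surjects_wt maxW; exact: quot_surjects.
by rewrite -wt_min_module; exact: surjects_wt Wmin.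
Qed.

(** Each pair of bounds has weight set that of [V], so each one satisfies the
    property of the other, and surjections in both directions compose to a
    scalar. *)
Lemma bounds_unique (Vmax Vmin : lieModType g) :
  surjects M Vmax -> surjects M Vmin -> weight_set_bounds lam (wt V) Vmax Vmin ->
  lmod_iso Vmax max_module /\ lmod_iso Vmin min_module.
Proof.
move=> hmax hmin bnd; have [/(_ erefl)[maxV Vmin_] _] := bnd V hV.
have maxmin := surjects_trans maxV Vmin_.
have self (W : lieModType g) : surjects W W by exists idfun; split=> // w; exists w.
have wmax : wt Vmax = wt V by apply/(bnd _ hmax); split=> //; exact: self.
have wmin : wt Vmin = wt V by apply/(bnd _ hmin); split=> //; exact: self.
have [v1 hv1] := surjects_hw hmax; have [v2 hv2] := surjects_hw hmin.
have [max' _] := (bnd max_module (quot_surjects _)).1 wt_max_module.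
have [_ min'] := (bnd min_module (quot_surjects _)).1 wt_min_module.
split.
  by apply: (surjects_antisym hv1) => //; exact: max_module_surjects.
by apply: (surjects_antisym hv2) => //; exact: surjects_min_module.
Qed.

End Interval.

Unset Implicit Arguments.

Theorem theorem4 (R : realType) (I : finType) (A : I -> I -> int)
    (hA : generalized_cartan A) (rz : realization R[i] A) (g : kac_moody rz)
    (lam : dual (cartan rz)) (V : lieModType g)
    (hV : surjects (verma g lam) V) (V_neq0 : exists v : V, v != 0) :
  exists Vmax Vmin : lieModType g,
    [/\ surjects (verma g lam) Vmax /\ surjects (verma g lam) Vmin,
        weight_set_bounds lam (wt V) Vmax Vmin,
        forall Vmax' Vmin' : lieModType g,
          surjects (verma g lam) Vmax' -> surjects (verma g lam) Vmin' ->
          weight_set_bounds lam (wt V) Vmax' Vmin' ->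
          lmod_iso Vmax' Vmax /\ lmod_iso Vmin' Vmin
      & wt Vmax = wt V /\ wt Vmin = wt V].
Proof.
have char0 n : n.+1%:R != 0 :> R[i] by rewrite pnatr_eq0.
have [f [fm fs]] := hV.
exists (max_module lam V), (min_module f); split.
- by split; exact: quot_surjects.
- exact: min_max_bounds.
- by move=> Vmax Vmin; exact: bounds_unique.
- by split; [exact: wt_max_module | exact: wt_min_module].
Qed.
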